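(* Let $X,Y,Z,P$ be Asplund spaces, $K\subset Z$ a closed convex pointed cone with $\operatorname{int}K\ne\emptyset$, $g:X\times P\to Z$ a map, $H:X\times P\rightrightarrows Y$ a set-valued map with closed graph, and $S(p)=\{x\in X\mid 0\in H(x,p)\}$, $\operatorname{Gr}S=\{(p,x)\mid x\in S(p)\}$. Let $(\overline{x},\overline{p})\in X\times P$ and $L>0$. Suppose: (1) $g$ is $L$-strictly Lipschitz at $(\overline{x},\overline{p})$: $g$ is strictly Lipschitz at $(\overline{x},\overline{p})$ and $\|g(x,p)-g(u,q)\|\le L(\|x-u\|+\|p-q\|)$ for $(x,p),(u,q)$ in a neighborhood of $(\overline{x},\overline{p})$; (2) $(\overline{x},\overline{p})$ is a local weak solution of ''minimize $g(x,p)$ subject to $0\in H(x,p)$'': $0\in H(\overline{x},\overline{p})$ and there exist neighborhoods $U$ of $\overline{x}$, $W$ of $\overline{p}$ with $g(x,p)-g(\overline{x},\overline{p})\notin-\operatorname{int}K$ for all $(x,p)\in U\times W$ with $0\in H(x,p)$; (3) there exists $r>0$ such that $d((p,x),\operatorname{Gr}S)\le r\,d((x,p,0),\operatorname{Gr}H)$ for all $(x,p)$ in a neighborhood of $(\overline{x},\overline{p})$. Then for every $e\in\operatorname{int}K$ there exist $z^*\in K^*$ with $z^*(e)=1$ and $y^*\in Y^*$ such that \[ (0,0)\in\partial(z^*\circ g)(\overline{x},\overline{p})+D_N^*H((\overline{x},\overline{p}),0)(y^* ). \]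
   Context: Products carry the sum norm; $d(z,A)=\inf_{a\in A}\|z-a\|$, $d(z,\emptyset)=\infty$. $K^*=\{z^*\in Z^*\mid z^*(z)\ge0\ \forall z\in K\}$. A map $h:W\to Z$ is strictly Lipschitz at $\overline{w}$ if it is Lipschitz around $\overline{w}$ and there is a neighborhood $V_0$ of $0$ in $W$ such that $(t_k^{-1}(h(w_k+t_kv)-h(w_k)))_k$ has a norm convergent subsequence whenever $v\in V_0$, $w_k\to\overline{w}$, $t_k\downarrow0$. For $\Omega$ in an Asplund space and $\overline{x}\in\Omega$: Fréchet normal cone $\widehat N(\Omega,x)=\{x^*\mid\limsup_{u\to x,u\in\Omega}\frac{x^*(u-x)}{\|u-x\|}\le0\}$; limiting normal cone $N(\Omega,\overline{x})$ is the set of $w^*$-limits of $x_n^*\in\widehat N(\Omega,x_n)$ with $x_n\to\overline{x}$, $x_n\in\Omega$. Limiting subdifferential $\partial\varphi(\overline{x})=\{x^*\mid(x^*,-1)\in N(\operatorname{epi}\varphi,(\overline{x},\varphi(\overline{x})))\}$. Normal coderivative of $F$ at $(w,y)\in\operatorname{Gr}F$: $D_N^*F(w,y)(y^* )=\{w^*\mid(w^*,-y^* )\in N(\operatorname{Gr}F,(w,y))\}$. *)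

(* Defs.v *)
From HB Require Import structures.
From mathcomp Require Import all_boot all_order all_algebra.
From mathcomp Require Import all_classical all_reals all_analysis.
Set Implicit Arguments. Unset Strict Implicit. Unset Printing Implicit Defensive.
Import Order.TTheory GRing.Theory Num.Theory.
Import numFieldNormedType.Exports.
Local Open Scope classical_set_scope.
Local Open Scope ring_scope.

Definition nrm (R : realType) (V : normedModType R) : V -> R := fun x => `|x|.

Definition is_dual (R : realType) (V : normedModType R) (f : V -> R) : Prop :=
  (forall (a : R) (u v : V), f (a *: u + v) = a * f u + f v) /\ continuous f.

Definition sum_norm (R : realType) (V W : normedModType R)
  (n1 : V -> R) (n2 : W -> R) : V * W -> R := fun z => n1 z.1 + n2 z.2.

(** Asplund: every separable linear subspace M has separable dual M^*.
    Dual of M: linear functionals on M bounded on M; dual-norm distance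
    <= eps is expressed as |f m - phi m| <= eps ||m|| on M. *)
Definition subspace (R : realType) (V : normedModType R) (M : set V) : Prop :=
  M 0 /\ forall (a : R) (u v : V), M u -> M v -> M (a *: u + v).
Definition separable_in (R : realType) (V : normedModType R) (M : set V) : Prop :=
  exists d : nat -> V, (forall n, M (d n)) /\
    forall m, M m -> forall eps : R, 0 < eps -> exists n, `|m - d n| < eps.
Definition dual_on (R : realType) (V : normedModType R) (M : set V) (f : V -> R) :=
  (forall (a : R) (u v : V), M u -> M v -> f (a *: u + v) = a * f u + f v) /\
  exists C : R, forall m, M m -> `|f m| <= C * `|m|.
Definition separable_dual (R : realType) (V : normedModType R) (M : set V) : Prop :=
  exists phi : nat -> V -> R, (forall n, dual_on M (phi n)) /\
    forall f, dual_on M f -> forall eps : R, 0 < eps ->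
      exists n, forall m, M m -> `|f m - phi n m| <= eps * `|m|.
Definition asplund (R : realType) (V : completeNormedModType R) : Prop :=
  forall M : set V, subspace M -> separable_in M -> separable_dual M.

(** Fréchet normal cone w.r.t. a norm [nrm] (limsup <= 0 unfolded). *)
Definition frechet_normal (R : realType) (V : normedModType R) (nV : V -> R)
  (A : set V) (x : V) (xs : V -> R) : Prop :=
  A x /\ is_dual xs /\
  forall eps : R, 0 < eps -> exists delta : R, 0 < delta /\
    forall u, A u -> nV (u - x) < delta -> xs (u - x) <= eps * nV (u - x).

Definition limiting_normal (R : realType) (V : normedModType R) (nV : V -> R)
  (A : set V) (xb : V) (xs : V -> R) : Prop :=
  A xb /\ is_dual xs /\
  exists (x : nat -> V) (xsn : nat -> V -> R),
    (forall n, A (x n)) /\ x @ \oo --> xb /\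
    (forall n, frechet_normal nV A (x n) (xsn n)) /\
    forall v, (fun n => xsn n v) @ \oo --> xs v.

Definition epi (R : realType) (V : normedModType R) (phi : V -> R) : set (V * R) :=
  [set z | phi z.1 <= z.2].
Definition limiting_subdiff (R : realType) (V : normedModType R) (nV : V -> R)
  (phi : V -> R) (xb : V) (xs : V -> R) : Prop :=
  limiting_normal (sum_norm nV (@nrm R R^o)) (epi phi) (xb, phi xb)
    (fun z => xs z.1 - z.2).

Definition graph (R : realType) (W Y : normedModType R) (F : W -> set Y) : set (W * Y) :=
  [set z | F z.1 z.2].
Definition normal_coderiv (R : realType) (W Y : normedModType R)
  (nW : W -> R) (nY : Y -> R) (F : W -> set Y) (w : W) (y : Y)
  (ys : Y -> R) (ws : W -> R) : Prop :=
  limiting_normal (sum_norm nW nY) (graph F) (w, y) (fun z => ws z.1 - ys z.2).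

(** Distance (extended real, d(z, empty) = +oo). *)
Definition dist (R : realType) (V : normedModType R) (nV : V -> R)
  (z : V) (A : set V) : \bar R :=
  ereal_inf [set (nV (z - a))%:E | a in A].

Definition convex_cone (R : realType) (Z : normedModType R) (K : set Z) : Prop :=
  K 0 /\ (forall (t : R) u, 0 <= t -> K u -> K (t *: u)) /\
  (forall u v, K u -> K v -> K (u + v)).
Definition pointed (R : realType) (Z : normedModType R) (K : set Z) : Prop :=
  forall u, K u -> K (- u) -> u = 0.
Definition dual_cone (R : realType) (Z : normedModType R) (K : set Z) : set (Z -> R) :=
  [set zs | is_dual zs /\ forall z, K z -> 0 <= zs z].

Definition strictly_lipschitz (R : realType) (W Z : normedModType R)
  (nW : W -> R) (h : W -> Z) (wb : W) : Prop :=
  (exists (C : R) (N : set W), nbhs wb N /\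
     forall a b, N a -> N b -> `|h a - h b| <= C * nW (a - b)) /\
  exists V0 : set W, nbhs (0 : W) V0 /\
    forall v, V0 v -> forall (w : nat -> W) (t : nat -> R),
      w @ \oo --> wb -> (forall k, 0 < t k) -> t @ \oo --> (0 : R) ->
      exists (phi : nat -> nat) (l : Z), (forall k, (phi k < phi k.+1)%N) /\
        (fun k => (t (phi k))^-1 *: (h (w (phi k) + t (phi k) *: v) - h (w (phi k))))
          @ \oo --> l.

(* Main.v *)
(** The Gerstewitz functional [s] of [e] scalarizes the problem: [s (g w - g wb)]
    is nonnegative on the feasible set near [wb], and by the metric estimate this
    becomes nonnegativity of [s z + C (|w - u| + |v|)] for all nearby
    [z = g w - g wb] and [(u, v)] in the graph of [H].  So a sublinear functional
    [N] is minimized, at [((wb, 0), (wb, 0))], over the product of the graphs of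
    [g - g wb] and [H].

    The key fact is a fuzzy multiplier rule: if [N (x - xb) >= 0] on a closed set
    [A] of an Asplund space near [xb], there are Frechet normals [xs] to [A] at
    points arbitrarily close to [xb] with [- xs <= N + mu |.|].  On a closed
    separable subspace [M] with separable dual, [N] and the norm are uniform limits
    of convex functions that are Frechet superdifferentiable everywhere, and a
    Borwein-Preiss iteration with these functions gives the rule.  By Hahn-Banach
    the existence of [xs] amounts to inequalities over finite families of points
    of [A]; a countable set of witnesses detects every violated one, so [M] can be
    chosen such that a normal relative to [M] yields a normal in the whole space.

    The rule also yields weak* sequential compactness of dual balls.  Passing to
    the limit in the multipliers, [- xs <= N + mu |.|] splits into [zs <= s] (so
    [zs] is in the dual cone and [zs e = 1]) and [a + b = 0].  A second use of the
    rule replaces the varying functionals [zn \o g] by the limit [zs \o g]. *)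

Require Import Defs.
From HB Require Import structures.
From mathcomp Require Import all_boot all_order all_algebra.
From mathcomp Require Import all_classical all_reals all_analysis.
From mathcomp Require Import ring lra.
Import Order.TTheory GRing.Theory Num.Theory.
Import numFieldNormedType.Exports.
Local Open Scope classical_set_scope.
Local Open Scope ring_scope.
Set Implicit Arguments. Unset Strict Implicit. Unset Printing Implicit Defensive.

(** * The Hahn-Banach theorem *)

(** The obstacle is that multipliers arrive only as weak* limits. The normals to the graph of
    [g - g wb] are Frechet subgradients of [zn \o g] with [zn] changing along the sequence, and
    weak* convergence of [zn] to [zs] gives no uniform smallness of [(zn - zs) \o g] near [wb].
    Strict Lipschitz continuity bridges this gap: difference quotients of [g] have norm convergent
    subsequences, along which the equibounded functionals [zn - zs] do tend to zero. Limiting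
    normals are defined by sequences, so cluster points of nets would not do; hence the need for
    sequential compactness. In the penalty constant [2 * Cs * L * r], [Cs] bounds [s], [L] is the
    Lipschitz constant of [g], [r] comes from the metric estimate, and [2] passes from the sum norm
    to the max norm, which is the product norm used throughout; the sum norm returns only when
    normals are handed to the definitions of the statement. *)

Definition sublinear (R : realType) (V : lmodType R) (p : V -> R) : Prop :=
  (forall u v, p (u + v) <= p u + p v) /\
  (forall t u, 0 <= t -> p (t *: u) = t * p u).

Definition linear_form (R : realType) (V : lmodType R) (f : V -> R) : Prop :=
  forall a u v, f (a *: u + v) = a * f u + f v.

(** [G c r] stands for the constraint [- r <= f c] on a functional [f] still to be found, so that a
    whole cone of constraints can be imposed at once. *)
Definition convex_cone_rel (R : realType) (V : lmodType R) (G : V -> R -> Prop) :=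
  [/\ G 0 0, forall u r v s, G u r -> G v s -> G (u + v) (r + s)
    & forall t u r, 0 <= t -> G u r -> G (t *: u) (t * r)].

Section HahnBanach.
Variables (R : realType) (V : lmodType R).
Implicit Types (p q f : V -> R) (G : V -> R -> Prop).

Lemma linear_formD f u v : linear_form f -> f (u + v) = f u + f v.
Proof. by move=> lf; rewrite -[u in LHS]scale1r lf mul1r. Qed.

Lemma linear_form0 f : linear_form f -> f 0 = 0.
Proof.
by move=> lf; apply: (@addrI _ (f 0)); rewrite addr0 -linear_formD // addr0.
Qed.

Lemma linear_formZ f a u : linear_form f -> f (a *: u) = a * f u.
Proof. by move=> lf; rewrite -[_ *: u]addr0 lf linear_form0 // addr0. Qed.

Lemma linear_formN f u : linear_form f -> f (- u) = - f u.
Proof. by move=> lf; rewrite -scaleN1r linear_formZ // mulN1r. Qed.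

Lemma linear_formB f u v : linear_form f -> f (u - v) = f u - f v.
Proof. by move=> lf; rewrite linear_formD // linear_formN. Qed.

Lemma sublinear0 p : sublinear p -> p 0 = 0.
Proof. by move=> [_ h]; rewrite -(scale0r 0) h // mul0r. Qed.

Lemma sublinear_opp_ge p u : sublinear p -> - p (- u) <= p u.
Proof.
move=> sp; have := sp.1 u (- u); rewrite subrr sublinear0 // => h; lra.
Qed.

Lemma sublinear_add p q : sublinear p -> sublinear q ->
  sublinear (fun x => p x + q x).
Proof.
move=> [p1 p2] [q1 q2]; split=> [u v|t u t0].
  by have := p1 u v; have := q1 u v; lra.
by rewrite p2 // q2 // mulrDr.
Qed.

Lemma inf_image_le (T : Type) (A : set T) (F : T -> R) b x :
  (forall y, A y -> b <= F y) -> A x -> inf [set F y | y in A] <= F x.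
Proof.
move=> lb Ax; apply: ge_inf; last by exists x.
by exists b => _ [y Ay <-]; exact: lb.
Qed.

Lemma le_inf_image (T : Type) (A : set T) (F : T -> R) b :
  A !=set0 -> (forall y, A y -> b <= F y) -> b <= inf [set F y | y in A].
Proof.
move=> [x Ax] lb; apply: lb_le_inf; first by exists (F x), x.
by move=> _ [y Ay <-]; exact: lb.
Qed.

Lemma sup_image_ge (T : Type) (A : set T) (F : T -> R) b x :
  (forall y, A y -> F y <= b) -> A x -> F x <= sup [set F y | y in A].
Proof.
move=> ub Ax; apply: ub_le_sup; last by exists x.
by exists b => _ [y Ay <-]; exact: ub.
Qed.

Lemma sup_image_le (T : Type) (A : set T) (F : T -> R) b :
  A !=set0 -> (forall y, A y -> F y <= b) -> sup [set F y | y in A] <= b.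
Proof.
move=> [x Ax] ub; apply: ge_sup; first by exists (F x), x.
by move=> _ [y Ay <-]; exact: ub.
Qed.

Section ConeInf.
Variables (p : V -> R) (G : V -> R -> Prop).
Hypotheses (sp : sublinear p) (cG : convex_cone_rel G).
Hypothesis pG : forall c r, G c r -> 0 <= p c + r.

(** The infimal convolution of [p] with the constraints: a linear functional below it is below [p]
    (use [G 0 0]) and, evaluated at [- c], satisfies each constraint [G c r]. *)
Definition cone_inf (h : V) : R :=
  inf [set p (h + z.1) + z.2 | z in [set z : V * R | G z.1 z.2]].

Lemma cone_inf_lb h z : G z.1 z.2 -> - p (- h) <= p (h + z.1) + z.2.
Proof.
move=> Gz; have := pG Gz; have := sp.1 (h + z.1) (- h).
rewrite addrAC subrr add0r; lra.
Qed.

Lemma cone_inf_le h c r : G c r -> cone_inf h <= p (h + c) + r.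
Proof.
move=> Gcr; apply: (@inf_image_le _ _ (fun z : V * R => p (h + z.1) + z.2)
  (- p (- h)) (c, r)) => //= z; exact: cone_inf_lb.
Qed.

Lemma le_cone_inf h b : (forall c r, G c r -> b <= p (h + c) + r) ->
  b <= cone_inf h.
Proof.
move=> hb; apply: le_inf_image; first by exists (0, 0) => /=; case: cG.
by move=> [c r] /= Gcr; exact: hb.
Qed.

Lemma cone_inf_le0 h : cone_inf h <= p h.
Proof. by have [G0 _ _] := cG; have := cone_inf_le h G0; rewrite !addr0. Qed.

Lemma cone_inf_sublinear : sublinear cone_inf.
Proof.
have [G0 GD GZ] := cG.
have zero : cone_inf 0 = 0.
  apply/eqP; rewrite eq_le -{1}(sublinear0 sp) cone_inf_le0 /=.
  by apply: le_cone_inf => c r Gcr; rewrite add0r; exact: pG.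
have sc t u : 0 < t -> cone_inf (t *: u) <= t * cone_inf u.
  move=> t0; rewrite mulrC -ler_pdivrMr //; apply: le_cone_inf => c r Gcr.
  rewrite ler_pdivrMr //.
  have := cone_inf_le (t *: u) (GZ _ _ _ (ltW t0) Gcr).
  by rewrite -scalerDr (sp.2 _ _ (ltW t0)) -mulrDr mulrC.
split=> [u v|t u].
  rewrite -lerBlDr; apply: le_cone_inf => c r Gcr.
  rewrite lerBlDr -lerBlDl; apply: le_cone_inf => d s Gds.
  rewrite lerBlDl; apply: (le_trans (cone_inf_le _ (GD _ _ _ _ Gcr Gds))).
  by have := sp.1 (u + c) (v + d); rewrite addrACA; lra.
rewrite le_eqVlt => /orP[/eqP <-|t0]; first by rewrite scale0r mul0r zero.
apply/eqP; rewrite eq_le sc //=.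
have ti0 : 0 < t^-1 by rewrite invr_gt0.
have := sc _ (t *: u) ti0; rewrite scalerA mulVf ?gt_eqF // scale1r.
by rewrite -(ler_pM2l t0) mulrA divff ?gt_eqF // mul1r.
Qed.

End ConeInf.

(** Zorn's lemma applies because [- p (- x)] bounds every candidate from below, so infima over
    chains are finite; they stay subadditive because any two members of a chain are dominated by the
    larger one. *)
Lemma minimal_sublinear p : sublinear p -> exists q,
  [/\ sublinear q, forall x, q x <= p x &
      forall q', sublinear q' -> (forall x, q' x <= q x) -> q' = q].
Proof.
move=> sp.
pose T := {q : V -> R | sublinear q /\ forall x, q x <= p x}.
pose rel (a b : T) := `[< forall x, sval b x <= sval a x >].
have lb (a : T) x : - p (- x) <= sval a x.
  have [sa ap] := svalP a; apply: le_trans (sublinear_opp_ge _ sa).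
  by rewrite lerN2.
have [||| q hq] := @ZL_preorder T (exist _ p (conj sp (fun x => lexx _))) rel.
- by move=> a; apply/asboolP => x.
- move=> a b c /asboolP h1 /asboolP h2; apply/asboolP => x.
  exact: le_trans (h2 x) (h1 x).
- move=> A totA; have [[a0 Aa0]|A0] := pselect (A !=set0); last first.
    exists (exist _ p (conj sp (fun x => lexx _))) => s As.
    by case: A0; exists s.
  pose m x := inf [set sval a x | a in A].
  have mle a x : A a -> m x <= sval a x.
    by move=> Aa; apply: (@inf_image_le _ _ (fun a : T => sval a x) (- p (- x))) => // *; exact: lb.
  have lem x b : (forall a, A a -> b <= sval a x) -> b <= m x.
    by move=> h; apply: le_inf_image => //; exists a0.
  have sm : sublinear m.
    split=> [u v|t u t0].
      rewrite -lerBlDr; apply: (lem _ _) => a Aa.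
      rewrite lerBlDr -lerBlDl; apply: (lem v) => b Ab; rewrite lerBlDl.
      have [/asboolP h|/asboolP h] := totA _ _ Aa Ab.
        have := (svalP b).1.1 u v; have := mle _ (u + v) Ab.
        by have := h u; lra.
      have := (svalP a).1.1 u v; have := mle _ (u + v) Aa.
      by have := h v; lra.
    apply/eqP; rewrite eq_le; apply/andP; split.
      have [t1|t1] := eqVneq t 0; last first.
        have {}t0 : 0 < t by rewrite lt_def t1.
        rewrite mulrC -ler_pdivrMr //; apply: (lem _ _) => a Aa.
        by rewrite ler_pdivrMr // mulrC -((svalP a).1.2 _ _ (ltW t0)); exact: mle.
      rewrite t1 scale0r mul0r; apply: le_trans (mle _ _ Aa0) _.
      by rewrite (sublinear0 (svalP a0).1).
    apply: (lem _ _) => a Aa; rewrite ((svalP a).1.2 _ _ t0).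
    by apply: ler_wpM2l => //; exact: mle.
  have mp x : m x <= p x by apply: le_trans (mle _ _ Aa0) _; exact: (svalP a0).2.
  exists (exist _ m (conj sm mp)) => a Aa; apply/asboolP => x /=; exact: mle.
exists (sval q); split; [exact: (svalP q).1|exact: (svalP q).2|].
move=> q' sq' q'q.
have q'p x : q' x <= p x by apply: le_trans (q'q x) _; exact: (svalP q).2.
have /hq/asboolP qq' : rel q (exist _ q' (conj sq' q'p)) by exact/asboolP.
by apply/funext => x; apply/eqP; rewrite eq_le q'q qq'.
Qed.

(** The cone generated by the single constraint [p x <= f x]. *)
Definition ray_rel p x (c : V) (r : R) : Prop :=
  exists2 t : R, 0 <= t & c = t *: x /\ r = - (t * p x).

Lemma ray_rel_cone p x : convex_cone_rel (ray_rel p x).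
Proof.
split.
- by exists 0; rewrite // scale0r mul0r oppr0.
- move=> _ _ _ _ [t t0 [-> ->]] [s s0 [-> ->]]; exists (t + s).
    exact: addr_ge0.
  by rewrite scalerDl mulrDl opprD.
- move=> t _ _ t0 [s s0 [-> ->]]; exists (t * s); first exact: mulr_ge0.
  by rewrite scalerA mulrN mulrA.
Qed.

Lemma ray_rel_self p x : ray_rel p x x (- p x).
Proof. by exists 1; rewrite // scale1r mul1r. Qed.

Lemma ray_rel_ge0 p x c r : sublinear p -> ray_rel p x c r -> 0 <= p c + r.
Proof. by move=> sp [t t0 [-> ->]]; rewrite sp.2 // subrr. Qed.

Lemma Hahn_Banach p : sublinear p ->
  exists2 f, linear_form f & forall x, f x <= p x.
Proof.
move=> /minimal_sublinear[q [sq qp qmin]]; exists q => //.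
have qadd x y : q (x + y) = q x + q y.
  apply/eqP; rewrite eq_le sq.1 /=.
  have cG := ray_rel_cone q y; have pG c r := @ray_rel_ge0 q y c r sq.
  (* By minimality [q] equals its infimal convolution with the ray through [y], so
     [q x <= q (x + y) - q y], the converse of subadditivity. *)
  have := qmin _ (cone_inf_sublinear sq cG pG) (cone_inf_le0 sq cG pG).
  move=> /(congr1 (fun k => k x)) <-.
  by have := cone_inf_le sq pG x (ray_rel_self q y); lra.
have q0 : q 0 = 0 by exact: sublinear0.
have qN x : q (- x) = - q x.
  by apply/eqP; rewrite -addr_eq0 -qadd addrC subrr q0.
move=> a u v; rewrite qadd; congr (_ + _).
have [a0|a0] := leP 0 a; first exact: sq.2.
have := sq.2 (- a) u; rewrite oppr_ge0 => /(_ (ltW a0)).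
by rewrite scaleNr qN mulNr => /oppr_inj.
Qed.

Lemma Hahn_Banach_cone p G : sublinear p -> convex_cone_rel G ->
    (forall c r, G c r -> 0 <= p c + r) ->
  exists f, [/\ linear_form f, forall x, f x <= p x &
                forall c r, G c r -> - r <= f c].
Proof.
move=> sp cG pG.
have [f lf fp] := Hahn_Banach (cone_inf_sublinear sp cG pG).
exists f; split=> // [x|c r Gcr].
  exact: le_trans (fp x) (cone_inf_le0 sp cG pG x).
have := le_trans (fp (- c)) (cone_inf_le sp pG (- c) Gcr).
rewrite linear_formN // addNr sublinear0 //; lra.
Qed.

Lemma Hahn_Banach_support p x : sublinear p ->
  exists f, [/\ linear_form f, forall y, f y <= p y & f x = p x].
Proof.
move=> sp; have pG c r := @ray_rel_ge0 p x c r sp.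
have [f [lf fp fG]] := Hahn_Banach_cone sp (ray_rel_cone p x) pG.
exists f; split=> //; apply/eqP; rewrite eq_le fp /=.
by have := fG _ _ (ray_rel_self p x); rewrite opprK.
Qed.

End HahnBanach.

(** * Sequential convergence and completeness in normed spaces *)

Definition conv (R : realType) (V : normedModType R) (u : nat -> V) (l : V) :=
  forall eps : R, 0 < eps -> exists N, forall n, (N <= n)%N -> `|u n - l| <= eps.

Definition cauchy_seq (R : realType) (V : normedModType R) (u : nat -> V) :=
  forall eps : R, 0 < eps -> exists N, forall n m, (N <= n)%N -> (N <= m)%N ->
    `|u n - u m| <= eps.

Definition seq_complete (R : realType) (V : normedModType R) :=
  forall u : nat -> V, cauchy_seq u -> exists l, conv u l.

Section Convergence.
Variables (R : realType).

Lemma convP (V : normedModType R) (u : nat -> V) l : conv u l <-> u @ \oo --> l.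
Proof.
split=> [cu|/cvgrPdist_le cu eps e0].
  apply/cvgrPdist_le => eps e0; have [N hN] := cu _ e0.
  by exists N => // n /= /hN; rewrite distrC.
have [N _ hN] := cu _ e0; exists N => n /hN /=.
by rewrite distrC.
Qed.

Lemma complete_seq_complete (V : completeNormedModType R) : seq_complete V.
Proof.
move=> u cu; exists (limn u); apply/convP/cauchy_cvgP.
apply: cauchy_exP => e e0; have [N hN] := cu _ (divr_gt0 e0 (ltr0n _ 2)).
exists (u N); exists N => // n /= Nn.
rewrite -ball_normE /=; have := hN N n (leqnn _) Nn; lra.
Qed.

Lemma realtype_seq_complete : seq_complete (R^o : normedModType R).
Proof. exact: (@complete_seq_complete R^o). Qed.

Lemma real_cauchy_conv (u : nat -> R) :
  (forall eps : R, 0 < eps -> exists N, forall n m, (N <= n)%N -> (N <= m)%N ->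
    `|u n - u m| <= eps) ->
  exists l : R, forall eps, 0 < eps -> exists N, forall n, (N <= n)%N ->
    `|u n - l| <= eps.
Proof. exact: realtype_seq_complete. Qed.

Lemma exists_inv_lt (e : R) : 0 < e -> exists n : nat, n.+1%:R^-1 < e.
Proof.
move=> e0; exists (Num.truncn e^-1); rewrite invf_plt ?posrE //.
exact: truncnS_gt.
Qed.

Lemma inv_succ_gt0 n : 0 < n.+1%:R^-1 :> R.
Proof. by rewrite invr_gt0. Qed.

Lemma inv_succ_le m n : (m <= n)%N -> n.+1%:R^-1 <= m.+1%:R^-1 :> R.
Proof. by move=> mn; rewrite lef_pV2 ?posrE // ler_nat. Qed.

End Convergence.

(** * Smooth approximation of sublinear functionals *)

(* Subtracting a small multiple of [\sum_i 2^-(i+1) (Q i)^2] from an affine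
   functional makes its supremum over [D] strong in every [Q i], because the
   parallelogram identity controls [Q i f - Q i g] for almost maximizers. *)
Section StrongMax.
Variables (R : realType) (T : Type) (D : set T) (mid : T -> T -> T).
Variables (Q : nat -> T -> R).
Hypothesis midD : forall f g, D f -> D g -> D (mid f g).
Hypothesis Q01 : forall i f, D f -> 0 <= Q i f <= 1.
Hypothesis Qmid : forall i f g, D f -> D g ->
  Q i (mid f g) <= (Q i f + Q i g) / 2.

Definition penalty_sum n f : R := \sum_(i < n) 2^-1 ^+ i.+1 * Q i f ^+ 2.
(** The series is encoded as the supremum of its partial sums, which increase and stay below [1] on
    [D]. *)
Definition penalty f : R := sup [set penalty_sum n f | n in [set: nat]].

Let w_gt0 i : 0 < 2^-1 ^+ i.+1 :> R.
Proof. by rewrite exprn_gt0 // invr_gt0. Qed.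

Lemma half_pow_sum n : \sum_(i < n) 2^-1 ^+ i.+1 = 1 - 2^-1 ^+ n :> R.
Proof.
elim: n => [|n IH]; first by rewrite big_ord0 expr0 subrr.
rewrite big_ord_recr /= IH exprS; lra.
Qed.

Lemma penalty_sum_le1 n f : D f -> penalty_sum n f <= 1.
Proof.
move=> Df; apply: (@le_trans _ _ (\sum_(i < n) 2^-1 ^+ i.+1)).
  apply: ler_sum => i _; rewrite ler_piMr ?(ltW (w_gt0 _)) //.
  have /andP[q0 q1] := Q01 i Df; exact: exprn_ile1.
by rewrite half_pow_sum gerBl exprn_ge0 // invr_ge0.
Qed.

Lemma penalty_ge n f : D f -> penalty_sum n f <= penalty f.
Proof.
move=> Df; apply: (@sup_image_ge _ _ _ (fun n => penalty_sum n f) 1) => // k _.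
exact: penalty_sum_le1.
Qed.

Lemma penalty_le f b : (forall n, penalty_sum n f <= b) -> penalty f <= b.
Proof. by move=> h; apply: sup_image_le => //; exists 0%N. Qed.

Lemma penalty_le1 f : D f -> penalty f <= 1.
Proof. by move=> Df; apply: penalty_le => n; exact: penalty_sum_le1. Qed.

Lemma penalty_ge0 f : D f -> 0 <= penalty f.
Proof. by move=> Df; have := penalty_ge 0 Df; rewrite /penalty_sum big_ord0. Qed.

Lemma penalty_sum_mono m n f : D f -> (m <= n)%N ->
  penalty_sum m f <= penalty_sum n f.
Proof.
move=> Df; elim: n => [|n IH]; first by rewrite leqn0 => /eqP ->.
rewrite leq_eqVlt => /orP[/eqP -> //|]; rewrite ltnS => /IH mn.
rewrite /penalty_sum big_ord_recr /=; apply: (le_trans mn).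
by rewrite lerDl mulr_ge0 ?(ltW (w_gt0 _)) // sqr_ge0.
Qed.

Lemma sq_mid i f g : D f -> D g ->
  Q i (mid f g) ^+ 2 <= (Q i f ^+ 2 + Q i g ^+ 2) / 2 - (Q i f - Q i g) ^+ 2 / 4.
Proof.
move=> Df Dg; have /andP[m0 _] := Q01 i (midD Df Dg).
have mm := Qmid i Df Dg; have : Q i (mid f g) ^+ 2 <= ((Q i f + Q i g) / 2) ^+ 2.
  by rewrite lerXn2r // nnegrE //; exact: le_trans mm.
by move/le_trans; apply; rewrite le_eqVlt; apply/orP; left; apply/eqP; field.
Qed.

Lemma penalty_mid i f g : D f -> D g -> penalty (mid f g) <=
  (penalty f + penalty g) / 2 - 2^-1 ^+ i.+1 * (Q i f - Q i g) ^+ 2 / 4.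
Proof.
move=> Df Dg; apply: penalty_le => n.
apply: le_trans (penalty_sum_mono (midD Df Dg) (leq_maxr i.+1 n)) _.
set k := maxn i.+1 n; have ik : (i < k)%N by rewrite leq_max leqnn.
have hf := penalty_ge k Df; have hg := penalty_ge k Dg.
suff : penalty_sum k (mid f g) <= (penalty_sum k f + penalty_sum k g) / 2
   - 2^-1 ^+ i.+1 * (Q i f - Q i g) ^+ 2 / 4 by lra.
rewrite /penalty_sum (bigD1 (Ordinal ik)) //= [X in (X + _) / 2](bigD1 (Ordinal ik)) //=.
rewrite [X in (_ + X) / 2](bigD1 (Ordinal ik)) //=.
set A := \sum_(_ < _ | _) _; set B := \sum_(_ < _ | _) _; set C := \sum_(_ < _ | _) _.
have hABC : A <= (B + C) / 2.
  rewrite -big_split /= mulr_suml; apply: ler_sum => j _.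
  rewrite -mulrDr -mulrA ler_pM2l ?w_gt0 //.
  by have := sq_mid j Df Dg; have := sqr_ge0 (Q j f - Q j g); lra.
have := sq_mid i Df Dg; rewrite -(ler_pM2l (w_gt0 i)); lra.
Qed.

Variables (ev : T -> R) (eta b : R).
Hypothesis eta_gt0 : 0 < eta.
Hypothesis evb : forall f, D f -> ev f <= b.
Hypothesis ev_mid : forall f g, ev (mid f g) = (ev f + ev g) / 2.
Hypothesis D0 : D !=set0.
(** Replaces compactness in a topology on [T]: almost maximizers are Cauchy in every [Q i], and a
    limit with [ev] upper and [Q i] lower semicontinuous is enough to attain the supremum. *)
Hypothesis Dcompact : forall F : nat -> T, (forall k, D (F k)) ->
  (forall i eps, 0 < eps -> exists N, forall n m, (N <= n)%N -> (N <= m)%N ->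
     `|Q i (F n) - Q i (F m)| <= eps) ->
  exists f, [/\ D f,
    (forall eps, 0 < eps -> exists N, forall n, (N <= n)%N -> ev (F n) <= ev f + eps) &
    forall i eps, 0 < eps -> exists N, forall n, (N <= n)%N ->
      Q i f <= Q i (F n) + eps].

Definition pen_obj f : R := ev f - eta * penalty f.
Definition pen_max : R := sup [set pen_obj f | f in D].

Lemma pen_obj_le f : D f -> pen_obj f <= pen_max.
Proof.
move=> Df; apply: (@sup_image_ge _ _ _ _ b) => // g Dg.
have := evb Dg; have := mulr_ge0 (ltW eta_gt0) (penalty_ge0 Dg).
by rewrite /pen_obj; lra.
Qed.

Lemma near_max_close tau i f g : D f -> D g ->
  pen_max - tau <= pen_obj f -> pen_max - tau <= pen_obj g ->
  eta * 2^-1 ^+ i.+1 / 4 * (Q i f - Q i g) ^+ 2 <= tau.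
Proof.
move=> Df Dg hf hg; have := pen_obj_le (midD Df Dg).
have := penalty_mid i Df Dg; rewrite -(ler_pM2l eta_gt0).
move: hf hg; rewrite /pen_obj ev_mid; lra.
Qed.

Lemma near_max_dist tau eps i f g : D f -> D g -> 0 < eps ->
  tau <= eta * 2^-1 ^+ i.+1 / 4 * eps ^+ 2 ->
  pen_max - tau <= pen_obj f -> pen_max - tau <= pen_obj g ->
  `|Q i f - Q i g| <= eps.
Proof.
move=> Df Dg e0 ht hf hg.
have := le_trans (near_max_close i Df Dg hf hg) ht.
have c0 : 0 < eta * 2^-1 ^+ i.+1 / 4 by rewrite divr_gt0 // mulr_gt0.
rewrite ler_pM2l // => h.
by rewrite -(ler_pXn2r (ltn0Sn 1)) ?nnegrE ?(ltW e0) // real_normK ?num_real.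
Qed.

Let gap (i : nat) (eps : R) := eta * 2^-1 ^+ i.+1 / 4 * eps ^+ 2.
Let gap_gt0 i eps : 0 < eps -> 0 < gap i eps.
Proof.
move=> e0; rewrite /gap mulr_gt0 // ?exprn_gt0 //.
by rewrite divr_gt0 // mulr_gt0.
Qed.

Lemma pen_max_attained : exists2 f, D f & pen_max <= pen_obj f.
Proof.
have hs : has_sup [set pen_obj f | f in D].
  split; first by case: D0 => f Df; exists (pen_obj f), f.
  by exists pen_max => _ [f Df <-]; exact: pen_obj_le.
have /choice[F hF] : forall n : nat, exists f, D f /\ pen_max - n.+1%:R^-1 <= pen_obj f.
  move=> n; have [_ [f Df <-] h] := sup_adherent (inv_succ_gt0 R n) hs.
  by exists f; split=> //; exact: ltW.
have hF1 n : D (F n) by case: (hF n).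
have hF2 m n : (m <= n)%N -> pen_max - m.+1%:R^-1 <= pen_obj (F n).
  by move=> mn; apply: le_trans (hF n).2; rewrite lerD2l lerN2 inv_succ_le.
have [|f [Df fx Qf]] := Dcompact hF1.
  move=> i eps e0; have [N hN] := exists_inv_lt (gap_gt0 i e0).
  exists N => n m Nn Nm; apply: (near_max_dist (tau := N.+1%:R^-1)) => //.
  - exact: ltW.
  - exact: hF2.
  - exact: hF2.
exists f => //; rewrite /pen_obj lerBrDr -lerBrDl mulrC -ler_pdivlMr //.
apply: penalty_le => n; apply/ler_addgt0Pr => eps e0.
have e30 : 0 < eps / 3 by rewrite divr_gt0.
(* For [0 <= a <= 1] and [d = eps / 9 <= 1], [(a + d) ^+ 2 <= a ^+ 2 + 3 * d], and the first [n]
   weights sum to [1 - 2^-1 ^+ n]. If [d >= 1] the bound is trivial, as the squares are at most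
   [1]. *)
have Qn : exists N, forall k, (N <= k)%N ->
    penalty_sum n f <= penalty_sum n (F k) + (1 - 2^-1 ^+ n) * (3 * (eps / 9)).
  have e90 : 0 < eps / 9 by rewrite divr_gt0.
  elim: n => [|n [N IH]].
    by exists 0%N => k _; rewrite /penalty_sum !big_ord0; lra.
  have [eps1|eps1] := leP 1 (eps / 9).
    exists N => k Nk; have := IH _ Nk; rewrite /penalty_sum !big_ord_recr /=.
    have h : 2^-1 ^+ n.+1 * Q n f ^+ 2 <= 2^-1 ^+ n.+1 * (3 * (eps/9)).
      rewrite ler_pM2l ?w_gt0 //; have /andP[a0 a1] := Q01 n Df.
      have : Q n f ^+ 2 <= 1 by exact: exprn_ile1.
      lra.
    have : 0 <= 2^-1 ^+ n.+1 * Q n (F k) ^+ 2 by rewrite mulr_ge0 ?sqr_ge0 ?(ltW (w_gt0 _)).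
    move: h; rewrite [2^-1 ^+ n.+1]exprS; lra.
  have [N' hN'] := Qf n _ e90; exists (maxn N N') => k; rewrite geq_max => /andP[Nk N'k].
  have := IH _ Nk; rewrite /penalty_sum !big_ord_recr /=.
  have h : 2^-1 ^+ n.+1 * Q n f ^+ 2 <=
           2^-1 ^+ n.+1 * (Q n (F k) ^+ 2 + 3 * (eps/9)).
    rewrite ler_pM2l ?w_gt0 //; have /andP[a0 a1] := Q01 n Df.
    have /andP[b0 b1] := Q01 n (hF1 k); have := hN' _ N'k => h.
    have : Q n f ^+ 2 <= (Q n (F k) + eps / 9) ^+ 2.
      by rewrite lerXn2r // nnegrE // (le_trans a0 h).
    rewrite sqrrD expr2 [(eps/9) ^+ 2]expr2 => /le_trans; apply.
    rewrite -!addrA expr2 lerD2l; nra.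
  move: h; rewrite [2^-1 ^+ n.+1]exprS; lra.
have {Qn}[N Qn] := Qn; have [N1 h1] := fx _ (mulr_gt0 eta_gt0 e30).
have [N2 h2] := exists_inv_lt (mulr_gt0 eta_gt0 e30).
pose k := maxn N (maxn N1 N2).
have kN : (N <= k)%N by rewrite leq_maxl.
have kN1 : (N1 <= k)%N by rewrite !leq_max leqnn orbT.
have kN2 : (N2 <= k)%N by rewrite !leq_max leqnn !orbT.
have := Qn _ kN; have := h1 _ kN1; have := hF2 _ _ kN2.
have := penalty_ge n (hF1 k); rewrite -(ler_pM2l eta_gt0) /pen_obj.
have p0 : 0 <= 2^-1 ^+ n * eps by rewrite mulr_ge0 ?exprn_ge0 ?invr_ge0 ?(ltW e0).
move=> a1 a2 a3 a4; rewrite -lerBlDr ler_pdivlMr //.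
have : (penalty_sum n f - eps) * eta <= (penalty_sum n (F k) - 2 * (eps / 3)) * eta.
  by rewrite ler_pM2r //; lra.
by move: h2 a2; move: (N2.+1%:R^-1) => v; lra.
Qed.

Lemma pen_max_strong : exists2 f0, D f0 /\ pen_obj f0 = pen_max &
  forall i eps, 0 < eps -> exists2 tau, 0 < tau & forall f, D f ->
    pen_max - tau <= pen_obj f -> `|Q i f - Q i f0| <= eps.
Proof.
have [f0 Df0 hf0] := pen_max_attained; exists f0.
  by split=> //; apply/eqP; rewrite eq_le hf0 pen_obj_le.
move=> i eps e0; exists (gap i eps); first exact: gap_gt0.
move=> f Df h; apply: (near_max_dist Df Df0 e0 (lexx _) h).
by apply: le_trans hf0; rewrite gerBl; exact/ltW/gap_gt0.
Qed.

End StrongMax.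

Section DualNorm.
Variables (R : realType) (V : normedModType R) (M : set V).
Hypothesis sM : Defs.subspace M.
Implicit Types (f g : V -> R).

Lemma subspaceD u v : M u -> M v -> M (u + v).
Proof. by move=> Mu Mv; have := sM.2 1 _ _ Mu Mv; rewrite scale1r. Qed.

Lemma subspaceZ a u : M u -> M (a *: u).
Proof. by move=> Mu; have := sM.2 a _ _ Mu sM.1; rewrite addr0. Qed.

Lemma subspaceN u : M u -> M (- u).
Proof. by rewrite -scaleN1r; exact: subspaceZ. Qed.

Lemma subspaceB u v : M u -> M v -> M (u - v).
Proof. by move=> Mu /subspaceN; exact: subspaceD. Qed.

Lemma dual_onD f u v : dual_on M f -> M u -> M v -> f (u + v) = f u + f v.
Proof. by move=> [lf _] Mu Mv; rewrite -[u in LHS]scale1r lf // mul1r. Qed.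

Lemma dual_on0 f : dual_on M f -> f 0 = 0.
Proof.
move=> df; have M0 := sM.1; apply: (@addrI _ (f 0)).
by rewrite addr0 -(dual_onD df M0 M0) addr0.
Qed.

Lemma dual_onZ f a u : dual_on M f -> M u -> f (a *: u) = a * f u.
Proof.
by move=> df Mu; rewrite -[_ *: u]addr0 df.1 ?(dual_on0 df) ?addr0 //; exact: sM.1.
Qed.

Lemma dual_onN f u : dual_on M f -> M u -> f (- u) = - f u.
Proof. by move=> df Mu; rewrite -scaleN1r (dual_onZ _ df) // mulN1r. Qed.

Lemma dual_onB f u v : dual_on M f -> M u -> M v -> f (u - v) = f u - f v.
Proof.
by move=> df Mu Mv; rewrite (dual_onD df) ?(dual_onN df) //; exact: subspaceN.
Qed.

Lemma dual_on_le_norm f C : dual_on M f -> (forall m, M m -> f m <= C * `|m|) ->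
  forall m, M m -> `|f m| <= C * `|m|.
Proof.
move=> df fC m Mm; rewrite ler_norml fC // andbT.
by have := fC _ (subspaceN Mm); rewrite (dual_onN df) // normrN; lra.
Qed.

Lemma linear_dual_on f C : linear_form f -> (forall m, f m <= C * `|m|) ->
  dual_on M f.
Proof.
move=> lf fC; split=> [a u v _ _|]; first exact: lf.
exists C => m _; rewrite ler_norml fC andbT.
by have := fC (- m); rewrite linear_formN // normrN; lra.
Qed.

Definition dual_norm f : R := sup [set f m | m in [set m | M m /\ `|m| <= 1]].

Lemma dual_norm_le f c : (forall m, M m -> `|m| <= 1 -> f m <= c) ->
  dual_norm f <= c.
Proof.
move=> h; apply: sup_image_le; first by exists 0 => /=; split; [exact: sM.1|rewrite normr0].
by move=> m [Mm m1]; exact: h.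
Qed.

Lemma dual_norm_ub f c m : (forall m, M m -> `|m| <= 1 -> f m <= c) ->
  M m -> `|m| <= 1 -> f m <= dual_norm f.
Proof.
by move=> h Mm m1; apply: (@sup_image_ge _ _ _ f c) => // y [My y1]; exact: h.
Qed.

End DualNorm.

Section SmoothApprox.
Variables (R : realType) (V : normedModType R) (M : set V).
Hypothesis sM : Defs.subspace M.
Hypotheses (sepM : separable_in M) (sepD : separable_dual M).
Variables (q : V -> R) (C eta : R).
Hypotheses (sq : sublinear q) (qC : forall x, q x <= C * `|x|).
Hypotheses (C_gt0 : 0 < C) (eta_gt0 : 0 < eta).

Let D : set (V -> R) := [set f | dual_on M f /\ forall x, M x -> f x <= q x].
Let mid (f g : V -> R) : V -> R := fun x => (f x + g x) / 2.

Let midD f g : D f -> D g -> D (mid f g).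
Proof.
move=> [[lf [Cf hf]] fq] [[lg [Cg hg]] gq]; split; last first.
  by move=> x Mx; have := fq _ Mx; have := gq _ Mx; rewrite /mid; lra.
split=> [a u v Mu Mv|]; first by rewrite /mid lf // lg //; field.
exists ((Cf + Cg) / 2) => m Mm; have := hf _ Mm; have := hg _ Mm.
rewrite /mid normrM [ `|2^-1| ]gtr0_norm ?invr_gt0 //.
by have := ler_normD (f m) (g m); lra.
Qed.

Let D_lip f m : D f -> M m -> `|f m| <= C * `|m|.
Proof.
move=> [df fq] Mm; apply: (dual_on_le_norm sM df) => // y My.
exact: le_trans (fq _ My) (qC _).
Qed.

(* [kappa] is the conjugate of the penalty restricted to the functionals below
   [q]. Taking the distances to a dense sequence of the dual among the [Q i]
   turns strong maximality into norm convergence of almost maximizers, which is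
   Frechet superdifferentiability of [kappa]. *)
Lemma smooth_approx : exists kappa : V -> R,
  [/\ forall x, M x -> q x - eta <= kappa x <= q x,
      forall x y, M x -> M y -> kappa y <= kappa x + C * `|y - x| &
      forall x, M x -> exists f, [/\ dual_on M f, forall h, M h -> f h <= q h &
        forall eps, 0 < eps -> exists2 delta, 0 < delta & forall h, M h ->
          `|h| <= delta -> kappa (x + h) <= kappa x + f h + eps * `|h| ]].
Proof.
have [d [Md dd]] := sepM; have [phi [dphi phid]] := sepD.
have /choice[B0 hB0] : forall n, exists c, forall m, M m -> `|phi n m| <= c * `|m|.
  by move=> n; have [_] := dphi n.
pose B n := `|B0 n| + C.
have B_gt0 n : 0 < B n by rewrite /B ltr_wpDl.
have hB n f m : D f -> M m -> `|m| <= 1 -> `|f m - phi n m| <= B n.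
  move=> Df Mm m1; apply: le_trans (ler_normB _ _) _; rewrite /B addrC.
  apply: lerD.
    apply: le_trans (hB0 n _ Mm) _; apply: le_trans (ler_norm _) _.
    by rewrite normrM normr_id ler_piMr.
  by apply: le_trans (D_lip Df Mm) _; rewrite ler_piMr // ltW.
have hB' n f m : D f -> M m -> `|m| <= 1 -> (fun m => f m - phi n m) m <= B n.
  by move=> Df Mm m1; exact: le_trans (ler_norm _) (hB _ _ _ Df Mm m1).
pose Bd n := C * `|d n| + 1.
have Bd_gt0 n : 0 < Bd n by rewrite /Bd ltr_wpDl // mulr_ge0 // ltW.
pose nd n f := dual_norm M (fun m => f m - phi n m).
have nd_ge0 n f : D f -> 0 <= nd n f.
  move=> Df; apply: le_trans (dual_norm_ub (fun m => hB' n f m Df) sM.1 _).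
    by rewrite /= (dual_on0 sM Df.1) (dual_on0 sM (dphi n)) subrr.
  by rewrite normr0.
(* Even indices carry the normalized dual distance to [phi], odd ones the value at a point of [d],
   shifted into [[0, 1]]. The values make a sequence with Cauchy [Q i] converge pointwise on [M];
   the distances turn closeness of the [Q i] into closeness in the dual norm. *)
pose Q i f := if odd i then (f (d i./2) + Bd i./2) / (2 * Bd i./2)
              else nd i./2 f / B i./2.
have Q01 i f : D f -> 0 <= Q i f <= 1.
  move=> Df; rewrite /Q; case: odd; last first.
    apply/andP; split; first by apply: divr_ge0; [exact: nd_ge0|exact: ltW].
    rewrite ler_pdivrMr // mul1r.
    by apply: dual_norm_le => // m; exact: hB'.
  have := D_lip Df (Md i./2); rewrite ler_norml => /andP[h1 h2].
  have b0 := Bd_gt0 i./2; apply/andP; split.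
    apply: divr_ge0; last by rewrite mulr_ge0 // ltW.
    by move: h1; rewrite /Bd; lra.
  by rewrite ler_pdivrMr ?mulr_gt0 // mul1r; move: h2; rewrite /Bd; lra.
have Qmid i f g : D f -> D g -> Q i (mid f g) <= (Q i f + Q i g) / 2.
  move=> Df Dg; rewrite /Q; case: odd.
    by rewrite /mid -!mulrDl le_eqVlt; apply/orP; left; apply/eqP; field; rewrite gt_eqF.
  rewrite -mulrDl mulrAC ler_pM2r ?invr_gt0 //.
  apply: dual_norm_le => // m Mm m1; rewrite /mid.
  have := dual_norm_ub (fun m => hB' i./2 f m Df) Mm m1.
  have := dual_norm_ub (fun m => hB' i./2 g m Dg) Mm m1.
  rewrite /= -/(nd i./2 f) -/(nd i./2 g); lra.
have Dcomp x : M x -> forall F : nat -> (V -> R), (forall k, D (F k)) ->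
  (forall i eps, 0 < eps -> exists N, forall n m, (N <= n)%N -> (N <= m)%N ->
     `|Q i (F n) - Q i (F m)| <= eps) ->
  exists f, [/\ D f,
    (forall eps, 0 < eps -> exists N, forall n, (N <= n)%N -> F n x <= f x + eps) &
    forall i eps, 0 < eps -> exists N, forall n, (N <= n)%N ->
      Q i f <= Q i (F n) + eps].
  move=> Mx F DF cF.
  have cd i eps : 0 < eps -> exists N, forall n m, (N <= n)%N -> (N <= m)%N ->
     `|F n (d i) - F m (d i)| <= eps.
    move=> e0; have b0 := Bd_gt0 i.
    have [N hN] := cF i.*2.+1 _ (divr_gt0 e0 (mulr_gt0 (ltr0n R 2) b0)).
    exists N => n m Nn Nm; have := hN _ _ Nn Nm; rewrite /Q /= odd_double /= uphalf_double.
    rewrite -mulrBl opprD addrACA subrr addr0 normrM [ `|_^-1| ]gtr0_norm ?invr_gt0 ?mulr_gt0 //.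
    by rewrite ler_pM2r ?invr_gt0 ?mulr_gt0.
  have cy y : exists l, M y -> forall eps, 0 < eps -> exists N, forall n, (N <= n)%N ->
     `|F n y - l| <= eps.
    have [My|nMy] := pselect (M y); last by exists 0.
    have [|l hl] := @real_cauchy_conv R (fun n => F n y); last by exists l.
    move=> eps e0; have e30 : 0 < eps / 3 by rewrite divr_gt0.
    have [i hi] := dd _ My _ (divr_gt0 e30 C_gt0); have [N hN] := cd i _ e30.
    exists N => n m Nn Nm; have := hN _ _ Nn Nm.
    have hk k : `|F k y - F k (d i)| <= eps / 3.
      rewrite -(dual_onB sM (DF k).1) //; apply: le_trans (D_lip (DF k) _) _.
        exact: subspaceB.
      by rewrite mulrC -ler_pdivlMr //; exact: ltW.
    move: (hk n) (hk m); rewrite !ler_norml; lra.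
  have [f hf] := choice cy.
  have le_lim y c : M y -> (exists N, forall n, (N <= n)%N -> F n y <= c) -> f y <= c.
    move=> My [N hN]; apply/ler_addgt0Pr => eps e0; have [N' hN'] := hf _ My _ e0.
    have := hN _ (leq_maxl N N'); have := hN' _ (leq_maxr N N').
    by rewrite ler_norml; lra.
  have Df : D f.
    split; last by move=> y My; apply: le_lim => //; exists 0%N => n _; exact: (DF n).2.
    split.
      move=> a u v Mu Mv; have Muv := sM.2 a _ _ Mu Mv.
      apply/eqP; rewrite -subr_eq0 -normr_le0; apply/ler_addgt0Pr => eps e0; rewrite add0r.
      have a1 : 0 < `|a| + 1 by rewrite ltr_wpDl.
      have e30 : 0 < eps / 3 by rewrite divr_gt0.
      have [N1 h1] := hf _ Muv _ e30; have [N2 h2] := hf _ Mv _ e30.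
      have [N3 h3] := hf _ Mu _ (divr_gt0 e30 a1).
      pose k := maxn N1 (maxn N2 N3).
      have := h1 k (leq_maxl _ _).
      have /h2 : (N2 <= k)%N by rewrite !leq_max leqnn orbT.
      have /h3 : (N3 <= k)%N by rewrite !leq_max leqnn !orbT.
      rewrite (DF k).1.1 // ler_pdivlMr // => k3.
      have : `|a * (F k u - f u)| <= eps / 3.
        by rewrite normrM mulrC; apply: le_trans k3; rewrite ler_wpM2l // lerDl.
      rewrite mulrBr !ler_norml; lra.
    exists C => y My; rewrite ler_norml; apply/andP; split; last first.
      apply: le_lim => //; exists 0%N => n _.
      exact: le_trans (ler_norm _) (D_lip (DF n) My).
    rewrite lerNl; apply/ler_addgt0Pr => eps e0; have [N hN] := hf _ My _ e0.
    have := hN _ (leqnn _); have := D_lip (DF N) My.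
    by rewrite !ler_norml; lra.
  exists f; split=> // [eps e0|i eps e0].
    have [N hN] := hf _ Mx _ e0; exists N => n /hN; rewrite ler_norml; lra.
  rewrite /Q; case: ifP => io.
    have b0 := Bd_gt0 i./2.
    have [N hN] := hf _ (Md i./2) _ (mulr_gt0 e0 (mulr_gt0 (ltr0n R 2) b0)).
    exists N => n /hN; rewrite ler_norml => h.
    rewrite ler_pdivrMr ?mulr_gt0 // mulrDl divfK ?gt_eqF ?mulr_gt0 //; lra.
  have b0 := B_gt0 i./2.
  have [N hN] := cF i _ e0; exists N => n Nn.
  rewrite ler_pdivrMr // mulrDl divfK ?gt_eqF //.
  (* The dual distance is a supremum of evaluations, hence lower semicontinuous under pointwise
     convergence. *)
  apply: dual_norm_le => // m Mm m1; rewrite lerBlDr.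
  apply: le_lim => //; exists N => k Nk; rewrite -lerBlDr.
  apply: le_trans (dual_norm_ub (fun m => hB' i./2 (F k) m (DF k)) Mm m1) _.
  rewrite -/(nd i./2 (F k)) -/(nd i./2 (F n)).
  have := hN _ _ Nk Nn; rewrite /Q io -mulrBl normrM [ `|_^-1| ]gtr0_norm ?invr_gt0 //.
  by rewrite ler_pdivrMr // ler_norml; lra.
have Dsup x : exists2 f, D f & f x = q x.
  have [f [lf fq fx]] := Hahn_Banach_support x sq; exists f => //; split=> //.
  by apply: (linear_dual_on _ lf (C := C)) => m; exact: le_trans (fq m) (qC m).
have D0 : D !=set0 by have [f Df _] := Dsup 0; exists f.
pose kappa x := pen_max D Q (fun f => f x) eta.
have ub x f : M x -> D f -> f x <= q x by move=> Mx Df; exact: Df.2.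
have obj_le x f : M x -> D f -> pen_obj Q (fun f => f x) eta f <= kappa x.
  by move=> Mx Df; apply: (pen_obj_le Q01 eta_gt0 (fun f => ub x f Mx)).
have kappa_le x c : (forall f, D f -> pen_obj Q (fun f => f x) eta f <= c) -> kappa x <= c.
  by move=> h; apply: sup_image_le.
have pen_ge0 f : D f -> 0 <= eta * penalty Q f.
  by move=> Df; rewrite mulr_ge0 ?(ltW eta_gt0) // (penalty_ge0 Q01).
exists kappa; split=> [x Mx|x y Mx My|x Mx].
- apply/andP; split.
    have [f Df fx] := Dsup x; apply: le_trans (obj_le _ _ Mx Df).
    rewrite /pen_obj fx lerD2l lerN2 ler_piMr ?(ltW eta_gt0) //.
    exact: (penalty_le1 Q01).
  apply: kappa_le => f Df; have := ub _ _ Mx Df; have := pen_ge0 _ Df.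
  by rewrite /pen_obj; lra.
- apply: kappa_le => f Df; have := obj_le _ _ Mx Df; rewrite /pen_obj.
  have := D_lip Df (subspaceB sM My Mx); rewrite (dual_onB sM Df.1) //.
  by rewrite ler_norml; lra.
- have [|f0 [Df0 hf0] str] := pen_max_strong midD Q01 Qmid eta_gt0
    (fun f => ub x f Mx) _ D0 (Dcomp x Mx).
    by [].
  exists f0; split; [exact: Df0.1|exact: Df0.2|] => eps e0.
  have e30 : 0 < eps / 3 by rewrite divr_gt0.
  have [n hn] := phid _ Df0.1 _ e30; have b0 := B_gt0 n.
  have [tau t0 htau] := str n.*2 _ (divr_gt0 e30 b0).
  (* On this ball [f h] and [f0 h] differ by at most [2 * C * |h| <= tau], so a functional missing
     the maximum at [x] by more than [tau] cannot overtake [f0] at [x + h]. Only almost maximizers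
     compete, and these are close to [f0]. *)
  exists (tau / (2 * C)) => [|h Mh hd]; first by rewrite divr_gt0 // mulr_gt0.
  apply: kappa_le => f Df; rewrite /pen_obj (dual_onD Df.1) //.
  have [ht|ht] := leP (kappa x - tau) (pen_obj Q (fun f => f x) eta f); last first.
    have := D_lip Df Mh; have := D_lip Df0 Mh; rewrite !ler_norml.
    move: ht hd; rewrite /pen_obj ler_pdivlMr ?mulr_gt0 //.
    have := mulr_ge0 (ltW e0) (normr_ge0 h); lra.
  have := htau _ Df ht; rewrite /Q odd_double doubleK -mulrBl normrM.
  rewrite [ `|_^-1| ]gtr0_norm ?invr_gt0 // ler_pM2r ?invr_gt0 // ler_norml => /andP[_ hnd].
  have nd0 : nd n f0 <= eps / 3.
    apply: dual_norm_le => // m Mm m1; apply: le_trans (ler_norm _) _.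
    by apply: le_trans (hn _ Mm) _; rewrite ler_piMr // ltW.
  have ndf : nd n f <= 2 * (eps / 3) by lra.
  have fh : f h - phi n h <= 2 * (eps / 3) * `|h|.
    have [->|h0] := eqVneq h 0.
      by rewrite (dual_on0 sM Df.1) (dual_on0 sM (dphi n)) normr0; lra.
    have hp : 0 < `|h| by rewrite normr_gt0.
    have := dual_norm_ub (fun m => hB' n f m Df) (subspaceZ sM `|h|^-1 Mh).
    rewrite normrZ normfV normr_id mulVf ?gt_eqF // => /(_ (lexx _)) /=.
    rewrite -/(nd n f) (dual_onZ sM _ Df.1) // (dual_onZ sM _ (dphi n)) //.
    rewrite -mulrBr mulrC ler_pdivrMr // => /le_trans; apply.
    by rewrite ler_pM2r.
  have := hn _ Mh; rewrite ler_norml => /andP[hn1 hn2].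
  have := obj_le _ _ Mx Df; rewrite /pen_obj; lra.
Qed.

End SmoothApprox.

(** * The fuzzy rule in a separable subspace *)

Definition seq_closed (R : realType) (V : normedModType R) (A : set V) : Prop :=
  forall u l, (forall n, A (u n)) -> conv u l -> A l.

Section Geometric.
Variables (R : realType) (V : normedModType R).

Lemma half_pow_gt0 n : 0 < 2^-1 ^+ n :> R.
Proof. by rewrite exprn_gt0 // invr_gt0. Qed.

Lemma half_powS n : 2^-1 ^+ n.+1 = 2^-1 ^+ n / 2 :> R.
Proof. by rewrite exprS mulrC. Qed.

Lemma exists_half_pow_lt (c e : R) : 0 < e -> exists n, c * 2^-1 ^+ n < e.
Proof.
move=> e0; pose c' := `|c| + 1; have c'0 : 0 < c' by rewrite /c' ltr_wpDl.
have [n hn] := exists_inv_lt (divr_gt0 e0 c'0); exists n.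
have : 2^-1 ^+ n <= n.+1%:R^-1 :> R.
  by rewrite exprVn lef_pV2 ?posrE ?exprn_gt0 // -natrX ler_nat ltn_expl.
move=> h; apply: (@le_lt_trans _ _ (c' * 2^-1 ^+ n)).
  by rewrite ler_pM2r ?half_pow_gt0 // /c'; have := ler_norm c; lra.
by rewrite mulrC -ltr_pdivlMr //; exact: le_lt_trans h hn.
Qed.

Lemma geometric_dist (u : nat -> V) (c : R) : 0 <= c ->
  (forall n, `|u n.+1 - u n| <= c * 2^-1 ^+ n.+1) ->
  forall n k, `|u (n + k)%N - u n| <= c * 2^-1 ^+ n.
Proof.
move=> c0 hu n k.
suff : `|u (n + k)%N - u n| <= c * (2^-1 ^+ n - 2^-1 ^+ (n + k)).
  by have := mulr_ge0 c0 (ltW (half_pow_gt0 (n + k))); lra.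
elim: k => [|k IH]; first by rewrite addn0 !subrr normr0 mulr0.
have := hu (n + k)%N; rewrite addnS !half_powS.
have := ler_normD (u (n + k).+1 - u (n + k)%N) (u (n + k)%N - u n).
by rewrite addrA subrK; lra.
Qed.

Lemma geometric_cauchy (u : nat -> V) (c : R) : 0 <= c ->
  (forall n, `|u n.+1 - u n| <= c * 2^-1 ^+ n.+1) -> cauchy_seq u.
Proof.
move=> c0 hu eps e0; have [N hN] := exists_half_pow_lt c (divr_gt0 e0 (ltr0n _ 2)).
exists N => n m Nn Nm; have := geometric_dist c0 hu N (n - N).
have := geometric_dist c0 hu N (m - N); rewrite !subnKC // [ `|u m - _| ]distrC.
have := ler_normD (u n - u N) (u N - u m); rewrite addrA subrK; lra.
Qed.

Lemma geometric_lim_dist (u : nat -> V) (c : R) l : 0 <= c ->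
  (forall n, `|u n.+1 - u n| <= c * 2^-1 ^+ n.+1) -> conv u l ->
  forall n, `|l - u n| <= c * 2^-1 ^+ n.
Proof.
move=> c0 hu ul n; apply/ler_addgt0Pr => e e0; have [N hN] := ul _ e0.
have := hN (n + N)%N (leq_addl _ _); have := geometric_dist c0 hu n N.
have := ler_normD (l - u (n + N)%N) (u (n + N)%N - u n).
by rewrite addrA subrK [ `|l - _| ]distrC; lra.
Qed.

End Geometric.

Section SeparableRule.
Variables (R : realType) (V : normedModType R) (M A : set V).
Hypothesis compV : seq_complete V.
Hypothesis sM : Defs.subspace M.
Hypotheses (clM : seq_closed M) (sepM : separable_in M) (sepD : separable_dual M).
Hypothesis clA : seq_closed A.
Variables (N : V -> R) (C rho mu : R) (xb : V).
Hypotheses (sN : sublinear N) (NC : forall x, N x <= C * `|x|) (C_gt0 : 0 < C).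
Hypotheses (rho_gt0 : 0 < rho) (mu_gt0 : 0 < mu) (Axb : A xb) (Mxb : M xb).
Hypothesis xb_min : forall x, A x -> M x -> `|x - xb| <= rho -> 0 <= N (x - xb).

(* A Borwein-Preiss iteration: [f n] is the objective perturbed by the first
   [n] smooth bumps, [x n] is an almost minimizer of [f n], and the bumps force
   [x] to be Cauchy. *)
Lemma separable_fuzzy_rule : exists x f, [/\ A x, M x & `|x - xb| <= mu] /\
  [/\ dual_on M f, forall h, M h -> - f h <= N h + mu * `|h| &
    forall eps, 0 < eps -> exists2 delta, 0 < delta & forall u, A u -> M u ->
      `|u - x| <= delta -> f (u - x) <= eps * `|u - x|].
Proof.
(* [theta] bounds the total displacement of the iteration; half of [rho] leaves room around the
   limit inside the region of minimality. *)
have [theta [theta_gt0 theta_rho theta_mu]] :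
    exists t : R, [/\ 0 < t, t <= rho / 2 & t <= mu / 2].
  exists (Num.min rho mu / 2); rewrite divr_gt0 ?lt_min ?rho_gt0 //.
  by rewrite !ler_pM2r ?invr_gt0 // !ge_min !lexx orbT.
have norm_sub : sublinear (fun x : V => `|x|).
  by split=> [u v|t u t0]; [exact: ler_normD|rewrite normrZ ger0_norm].
(* Chosen so that [e n + e n.+1 <= w n * eta n]. Two consecutive almost minimality conditions then
   keep the bump at most [eta n] at the new point, so the step is at most
   [2 * eta n = theta * 2^-1 ^+ n.+1]. *)
pose e n : R := theta * mu * 2^-1 ^+ n * 2^-1 ^+ n / 16.
have p_gt0 n := half_pow_gt0 R n.
have e_gt0 n : 0 < e n by rewrite /e divr_gt0 // !mulr_gt0.
have [k0 [k0N k0lip k0d]] := smooth_approx sM sepM sepD sN NC C_gt0 (e_gt0 0%N).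
pose eta n : R := theta * 2^-1 ^+ n / 4.
have eta_gt0 n : 0 < eta n by rewrite /eta divr_gt0 // !mulr_gt0.
have norm1 (x : V) : `|x| <= 1 * `|x| by rewrite mul1r.
have /choice[k hk] n := smooth_approx sM sepM sepD norm_sub norm1 ltr01 (eta_gt0 n).
(* The weights sum to [mu]; the bumps are 1-Lipschitz, so together they change slopes by at most
   [mu]. *)
pose w n : R := mu * 2^-1 ^+ n.+1.
have w_gt0 n : 0 < w n by rewrite mulr_gt0.
pose A' := [set x | [/\ A x, M x & `|x - xb| <= rho]].
have A'xb : A' xb by split=> //; rewrite subrr normr0 ltW.
(* The selection must be total in the function, so it falls back on [xb] when there is no lower
   bound; [fb] rules this case out afterwards. *)
have /choice[sel hsel] : forall z : nat * (V -> R), exists x, A' x /\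
    ((exists b, forall y, A' y -> b <= z.2 y) ->
     forall y, A' y -> z.2 x <= z.2 y + e z.1).
  move=> [n f]; have [[b hb]|nb] := pselect (exists b, forall y, A' y -> b <= f y); last first.
    by exists xb; split=> // /nb.
  have hi : has_inf [set f y | y in A'].
    split; first by exists (f xb), xb.
    by exists b => _ [y Ay <-]; exact: hb.
  have [_ [x A'x <-] hx] := inf_adherent (e_gt0 n) hi.
  exists x; split=> //= _ y A'y; apply: le_trans (ltW hx) _; rewrite lerD2r.
  exact: inf_image_le hb A'y.
pose step n (z : V * (V -> R)) :=
  let f := fun y => z.2 y + w n * k n (y - z.1) in (sel (n.+1, f), f).
pose st := fix st n := if n is n'.+1 then step n' (st n') else (xb, fun y => k0 (y - xb)).
pose x n := (st n).1; pose f n := (st n).2.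
have fS n y : f n.+1 y = f n y + w n * k n (y - x n) by [].
have A'x n : A' (x n).
  case: n => [|n]; first exact: A'xb.
  by have [] := hsel (n.+1, f n.+1).
have Mx n : M (x n) by have [] := A'x n.
have MB n y : M y -> M (y - x n) by move=> My; exact: subspaceB.
have fb n : exists b, forall y, A' y -> b <= f n y.
  elim: n => [|n [b hb]].
    exists (- e 0%N) => y [Ay My hy]; have /andP[+ _] := k0N _ (subspaceB sM My Mxb).
    by have := xb_min Ay My hy; rewrite /f /=; lra.
  exists (b - w n * eta n) => y A'y; have [_ My _] := A'y; rewrite fS.
  have [/(_ _ (MB n _ My)) /andP[h _] _ _] := hk n.
  have : w n * (- eta n) <= w n * k n (y - x n).
    by rewrite ler_pM2l //; have := normr_ge0 (y - x n); lra.
  by have := hb _ A'y; lra.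
have xmin n y : A' y -> f n (x n) <= f n y + e n.
  case: n => [|n] A'y; last exact: (hsel (n.+1, f n.+1)).2 (fb n.+1) _ A'y.
  have [Ay My hy] := A'y; have /andP[+ _] := k0N _ (subspaceB sM My Mxb).
  have /andP[_] := k0N _ sM.1; rewrite /f /x /= subrr (sublinear0 sN).
  by have := xb_min Ay My hy; lra.
have xstep n : `|x n.+1 - x n| <= theta * 2^-1 ^+ n.+1.
  have h1 := xmin n.+1 _ (A'x n); have h2 := xmin n _ (A'x n.+1).
  have [kb _ _] := hk n; have /andP[k1 _] := kb _ (MB n _ (Mx n.+1)).
  have /andP[_] := kb _ sM.1; rewrite normr0 => k2.
  move: h1; rewrite !fS subrr => h1.
  have wk : w n * k n 0 <= 0 by rewrite pmulr_rle0.
  have : w n * k n (x n.+1 - x n) <= w n * eta n.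
    have : e n + e n.+1 <= w n * eta n; last by lra.
    rewrite /e /w /eta half_powS; have : 0 < theta * mu * 2^-1 ^+ n * 2^-1 ^+ n.
      by rewrite !mulr_gt0.
    lra.
  rewrite ler_pM2l // => h; have := le_trans k1 h; rewrite /eta half_powS; lra.
have t0 := ltW theta_gt0.
have [xi hxi] := compV (geometric_cauchy t0 xstep).
have xd := geometric_lim_dist t0 xstep hxi.
have Mxi : M xi by exact: clM hxi.
have Axi : A xi by apply: clA hxi => n; have [] := A'x n.
have xib : `|xi - xb| <= theta by have := xd 0%N; rewrite expr0 mulr1.
have flip n y z : M y -> M z -> f n y <= f n z + (C + mu) * `|y - z|.
  move=> My Mz; suff : f n y <= f n z + (C + mu * (1 - 2^-1 ^+ n)) * `|y - z|.
    have := mulr_ge0 (ltW mu_gt0) (mulr_ge0 (ltW (p_gt0 n)) (normr_ge0 (y - z))); lra.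
  elim: n => [|n IH].
    rewrite expr0 subrr mulr0 addr0 /f /=.
    have := k0lip _ _ (subspaceB sM Mz Mxb) (subspaceB sM My Mxb).
    by rewrite opprB addrA subrK.
  rewrite !fS; have [_ /(_ _ _ (MB n _ Mz) (MB n _ My)) h _] := hk n.
  move: h; rewrite mul1r opprB addrA subrK -(ler_pM2l (w_gt0 n)).
  by move: IH; rewrite /w half_powS; lra.
(* The limit point is tested in each finite stage [f J], at the price of the slope [mu * 2^-1 ^+ J]
   of the bumps still to come. So only finite sums of bumps are ever differentiated. *)
have claimA J h : M h -> A' (xi + h) ->
    0 <= f J (xi + h) - f J xi + mu * 2^-1 ^+ J * `|h|.
  move=> Mh A'h; have Mxh : M (xi + h) by exact: subspaceD.
  have tail n : f (J + n)%N (xi + h) - f (J + n)%N xi <=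
      f J (xi + h) - f J xi + mu * (2^-1 ^+ J - 2^-1 ^+ (J + n)) * `|h|.
    elim: n => [|n IH]; first by rewrite addn0 subrr mulr0 mul0r addr0.
    rewrite addnS !fS; have [_ hl _] := hk (J + n)%N.
    have := hl _ _ (MB (J + n)%N _ Mxi) (MB (J + n)%N _ Mxh).
    rewrite mul1r opprB addrA subrK [xi + h - xi]addrAC subrr add0r.
    rewrite -(ler_pM2l (w_gt0 (J + n)%N)).
    by move: IH; rewrite /w half_powS; lra.
  apply/ler_addgt0Pr => eps eps0.
  pose c := theta * mu + (C + mu) * theta.
  have [n hn] := exists_half_pow_lt c eps0.
  pose m := (J + n)%N.
  have h1 := xmin m _ A'h; have h2 := flip m _ _ Mxi (Mx m); have h3 := xd m.
  have h4 : (C + mu) * `|xi - x m| <= (C + mu) * (theta * 2^-1 ^+ m).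
    by rewrite ler_pM2l // addr_gt0.
  have p1 k' : 2^-1 ^+ k' <= 1 :> R.
    by rewrite exprn_ile1 // ?invr_ge0 // invf_le1 // ler1n.
  have pm : 2^-1 ^+ m <= 2^-1 ^+ n :> R.
    by rewrite /m addnC exprD ler_piMr ?(ltW (p_gt0 _)).
  have e_le : e m <= theta * mu * 2^-1 ^+ m.
    have tm : 0 < theta * mu * 2^-1 ^+ m by rewrite !mulr_gt0.
    have : theta * mu * 2^-1 ^+ m * 2^-1 ^+ m <= theta * mu * 2^-1 ^+ m.
      by rewrite ler_piMr // ltW.
    rewrite /e; lra.
  have c0 : 0 < c by rewrite /c addr_gt0 ?mulr_gt0 ?addr_gt0.
  have : c * 2^-1 ^+ m <= c * 2^-1 ^+ n by rewrite ler_pM2l.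
  have := tail n; rewrite -/m.
  have : 0 <= mu * 2^-1 ^+ m * `|h| by rewrite !mulr_ge0 // ltW.
  move: hn; rewrite /c; lra.
have [g0 [dg0 g0N g0d]] := k0d _ (subspaceB sM Mxi Mxb).
have /choice[g hg] n : exists g, [/\ dual_on M g, forall h, M h -> g h <= `|h| &
    forall eps, 0 < eps -> exists2 delta, 0 < delta & forall h, M h -> `|h| <= delta ->
     k n (xi - x n + h) <= k n (xi - x n) + g h + eps * `|h|].
  by have [_ _ /(_ _ (MB n _ Mxi))] := hk n.
have g_abs n h : M h -> `|g n h| <= `|h|.
  move=> Mh; have [dg gle _] := hg n; rewrite -[leRHS]mul1r.
  by apply: (dual_on_le_norm sM dg) => // m /gle; rewrite mul1r.
pose G n h := g0 h + \sum_(j < n) w j * g j h.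
have GS n h : G n.+1 h = G n h + w n * g n h by rewrite /G big_ord_recr /= addrA.
have G0 h : G 0%N h = g0 h by rewrite /G big_ord0 addr0.
have claimB J eps : 0 < eps -> exists2 delta, 0 < delta & forall h, M h ->
    `|h| <= delta -> f J (xi + h) <= f J xi + G J h + eps * `|h|.
  elim: J eps => [|J IH] eps eps0.
    have [dl dl0 hdl] := g0d _ eps0; exists dl => // h Mh /(hdl _ Mh).
    by rewrite G0 /f /= addrAC.
  have [d1 d10 h1] := IH _ (divr_gt0 eps0 (ltr0n _ 2)).
  have e20 : 0 < eps / 2 / w J by rewrite !divr_gt0.
  have [_ _ /(_ _ e20)[d2 d20 h2]] := hg J.
  exists (Num.min d1 d2) => [|h Mh]; first by rewrite lt_min d10.
  rewrite le_min => /andP[hd1 hd2]; have := h1 _ Mh hd1.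
  have := h2 _ Mh hd2; rewrite -(ler_pM2l (w_gt0 J)) [xi - _ + h]addrAC !fS GS.
  rewrite [w J * (_ + eps / 2 / w J * _)]mulrDr [w J * (eps / 2 / w J * _)]mulrA.
  by rewrite [w J * (eps / 2 / w J)]mulrC divfK ?gt_eqF //; lra.
have Gstep h n : M h -> `|G n.+1 h - G n h| <= mu * `|h| * 2^-1 ^+ n.+1.
  move=> Mh; rewrite GS addrAC subrr add0r normrM gtr0_norm // /w mulrAC ler_pM2r //.
  by rewrite ler_pM2l // g_abs.
have Gc0 (h : V) : 0 <= mu * `|h| by rewrite mulr_ge0 // ltW.
have /choice[Gi hGi] h : exists l, M h -> forall n, `|l - G n h| <= mu * `|h| * 2^-1 ^+ n.
  have [Mh|nMh] := pselect (M h); last by exists 0.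
  have st' n : `|(G n.+1 h : R^o) - G n h| <= mu * `|h| * 2^-1 ^+ n.+1 by exact: Gstep.
  have [l hl] := realtype_seq_complete (@geometric_cauchy R R^o (fun n => G n h) _ (Gc0 h) st').
  by exists l => _; exact: (@geometric_lim_dist R R^o (fun n => G n h) _ _ (Gc0 h) st' hl).
have GiN h : M h -> Gi h <= N h + mu * `|h|.
  move=> Mh; have := hGi _ Mh 0%N; rewrite G0 expr0 mulr1 ler_norml.
  by have := g0N _ Mh; lra.
have Glin n a u v : M u -> M v -> G n (a *: u + v) = a * G n u + G n v.
  move=> Mu Mv; elim: n => [|n IH]; first by rewrite !G0 dg0.1.
  by rewrite !GS IH; have [[-> // _] _ _] := hg n; ring.
have Gilin a u v : M u -> M v -> Gi (a *: u + v) = a * Gi u + Gi v.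
  move=> Mu Mv; have Muv := sM.2 a _ _ Mu Mv.
  apply/eqP; rewrite -subr_eq0 -normr_le0; apply/ler_addgt0Pr => eps eps0; rewrite add0r.
  have [n hn] := exists_half_pow_lt (mu * `|a *: u + v| + `|a| * (mu * `|u|) + mu * `|v|) eps0.
  have h1 := hGi _ Muv n; have h2 := hGi _ Mv n.
  have h3 : `|a * (Gi u - G n u)| <= `|a| * (mu * `|u| * 2^-1 ^+ n).
    by rewrite normrM ler_wpM2l // hGi.
  move: h1; rewrite Glin //; move: h2 h3 hn; rewrite mulrBr.
  rewrite !ler_norml; lra.
exists xi, (fun h => - Gi h); split.
  by split=> //; apply: le_trans xib _; lra.
split.
- split=> [a u v Mu Mv|]; first by rewrite Gilin // opprD mulrN.
  exists (C + mu) => m Mm; rewrite normrN ler_norml; apply/andP; split; last first.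
    by apply: le_trans (GiN _ Mm) _; have := NC m; lra.
  have := GiN _ (subspaceN sM Mm); have := NC (- m); rewrite normrN.
  have := Gilin (- 1) _ _ Mm sM.1; rewrite addr0 scaleN1r mulN1r => ->.
  have := Gilin 0 _ _ sM.1 sM.1; rewrite scale0r addr0 mul0r add0r.
  have := Gilin 1 _ _ sM.1 sM.1; rewrite scale1r addr0 mul1r; lra.
- by move=> h Mh; rewrite opprK; exact: GiN.
(* One [mu * 2^-1 ^+ J] pays for the later bumps in [claimA], the other for replacing [G J] by its
   limit [Gi]. *)
- move=> eps eps0; have [J hJ] := exists_half_pow_lt (2 * mu) (divr_gt0 eps0 (ltr0n _ 2)).
  have [dl dl0 hdl] := claimB J _ (divr_gt0 eps0 (ltr0n _ 2)).
  exists (Num.min dl (rho / 2)) => [|u Au Mu]; first by rewrite lt_min dl0 divr_gt0.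
  rewrite le_min => /andP[ud ur]; set h := u - xi.
  have Mh : M h by exact: subspaceB.
  have uE : xi + h = u by rewrite addrC subrK.
  have A'u : A' (xi + h).
    rewrite uE; split=> //; have := ler_normD (u - xi) (xi - xb).
    by rewrite addrA subrK; lra.
  have := claimA J _ Mh A'u; have := hdl _ Mh ud.
  have := hGi _ Mh J; rewrite ler_norml.
  have : (2 * mu * 2^-1 ^+ J) * `|h| <= eps / 2 * `|h| by rewrite ler_wpM2r // ltW.
  lra.
Qed.

End SeparableRule.

(** * Separable reduction *)

Lemma linear_form_is_dual (R : realType) (V : normedModType R) (f : V -> R) C :
  linear_form f -> (forall x, f x <= C * `|x|) -> is_dual f.
Proof.
move=> lf fC; split=> // x; apply/cvgrPdist_lt => e e0.
pose c := `|C| + 1; have c0 : 0 < c by rewrite /c ltr_wpDl.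
apply/nbhs_ballP; exists (e / c) => /=; first exact: divr_gt0.
move=> y; rewrite -ball_normE /= => xy; rewrite -linear_formB //.
have hc z : f z <= c * `|z|.
  apply: le_trans (fC z) _; rewrite ler_wpM2r // /c.
  by have := ler_norm C; lra.
have : `|f (x - y)| <= c * `|x - y|.
  rewrite ler_norml hc andbT lerNl -linear_formN //.
  by apply: le_trans (hc _) _; rewrite normrN.
by move=> /le_lt_trans; apply; rewrite mulrC -ltr_pdivlMr.
Qed.

Section SeparableReduction.
Variables (R : realType) (V : normedModType R) (A : set V).
Variables (q : V -> R) (C : R).
Hypotheses (sq : sublinear q) (qC : forall x, q x <= C * `|x|) (C_gt0 : 0 < C).

(* An entry [(k, t, u)] stands for the constraint
   [xs (u - x) <= k.+1%:R^-1 * `|u - x|] taken with the multiplier [t]. *)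
Let entry := (nat * R * V)%type.

Definition cone_vec (x : V) (l : seq entry) : V :=
  \sum_(z <- l) z.1.2 *: (z.2 - x).
Definition cone_cost (x : V) (l : seq entry) : R :=
  \sum_(z <- l) z.1.2 * z.1.1.+1%:R^-1 * `|z.2 - x|.
Definition admissible (n : nat -> nat) (x : V) (l : seq entry) : Prop :=
  forall z, z \in l -> [/\ 0 <= z.1.2, A z.2 & `|z.2 - x| < (n z.1.1).+1%:R^-1].
(** A finite certificate that no functional below [q] meets the constraints at [x]: adding the
    constraints in [l] would give [q (cone_vec x l) + cone_cost x l >= 0]. Only finitely many radii
    enter, so they form a code in the countable type [seq nat]. *)
Definition infeasible (s : seq nat) (x : V) (l : seq entry) : Prop :=
  [/\ all (fun z => z.1.1 < size s)%N l, admissible (nth 0%N s) x l &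
      q (cone_vec x l) + cone_cost x l < 0].

(** A certificate is finitely many strict inequalities, and its value moves by at most [a * C + a]
    times the displacement of [x], where [a] is the sum of the multipliers. *)
Lemma infeasible_open s x l : infeasible s x l ->
  exists2 rho : R, 0 < rho & forall y, `|y - x| < rho -> infeasible s y l.
Proof.
move=> [sl adm neg].
have [r1 r10 h1] : exists2 rho : R, 0 < rho & forall y, `|y - x| < rho ->
    admissible (nth 0%N s) y l.
  elim: l adm {sl neg} => [|z l IH] adm; first by exists 1.
  have [|r r0 hr] := IH; first by move=> z' zl; apply: adm; rewrite inE zl orbT.
  have [t0 Az zx] := adm z (mem_head _ _).
  pose d := (nth 0%N s z.1.1).+1%:R^-1 - `|z.2 - x|.
  have d0 : 0 < d by rewrite subr_gt0.
  exists (Num.min r d) => [|y]; first by rewrite lt_min r0.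
  rewrite lt_min => /andP[yr yd] z'; rewrite inE => /orP[/eqP ->|]; last exact: hr.
  split=> //; have := ler_normD (z.2 - x) (x - y); rewrite addrA subrK.
  by rewrite [ `|x - y| ]distrC => h; apply: le_lt_trans h _; rewrite addrC -ltrBrDr.
have [K K0 hK] : exists2 K : R, 0 <= K & forall y,
    q (cone_vec y l) + cone_cost y l <= q (cone_vec x l) + cone_cost x l + K * `|y - x|.
  have [a a0 [ha hb]] : exists2 a : R, 0 <= a &
      (forall y, cone_vec y l = cone_vec x l + a *: (x - y)) /\
      forall y, cone_cost y l <= cone_cost x l + a * `|y - x|.
    elim: l adm {sl neg h1} => [|z l IH] adm.
      exists 0 => //; split=> y; rewrite /cone_vec /cone_cost !big_nil.
        by rewrite scale0r addr0.
      by rewrite mul0r addr0.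
    have [|a a0 [ha hb]] := IH; first by move=> z' zl; apply: adm; rewrite inE zl orbT.
    have [t0 _ _] := adm z (mem_head _ _).
    exists (z.1.2 + a); first exact: addr_ge0.
    split=> y; rewrite /cone_vec /cone_cost !big_cons.
      rewrite -/(cone_vec y l) -/(cone_vec x l) ha scalerDl addrACA; congr (_ + _).
      by rewrite -scalerDr addrA subrK.
    rewrite -/(cone_cost y l) -/(cone_cost x l) mulrDl addrACA; apply: lerD => //.
    have i0 := inv_succ_gt0 R z.1.1; have i1 : z.1.1.+1%:R^-1 <= 1 :> R.
      by have := inv_succ_le R (leq0n z.1.1); rewrite invr1.
    rewrite -!mulrA -mulrDr ler_wpM2l //.
    have := ler_normD (z.2 - x) (x - y); rewrite addrA subrK [ `|x - y| ]distrC => h.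
    apply: (@le_trans _ _ (z.1.1.+1%:R^-1 * (`|z.2 - x| + `|y - x|))).
      by rewrite ler_pM2l.
    by rewrite mulrDr lerD2l ler_piMl.
  exists (a * C + a) => [|y]; first by rewrite addr_ge0 // mulr_ge0 // ltW.
  rewrite ha; have := sq.1 (cone_vec x l) (a *: (x - y)).
  have : q (a *: (x - y)) <= a * (C * `|y - x|).
    by rewrite sq.2 // ler_wpM2l // distrC; apply: le_trans (qC _) _; rewrite distrC.
  have := hb y; lra.
pose v := - (q (cone_vec x l) + cone_cost x l).
have v0 : 0 < v by rewrite oppr_gt0.
have K10 : 0 < K + 1 by rewrite ltr_wpDl.
exists (Num.min r1 (v / (K + 1))) => [|y]; first by rewrite lt_min r10 divr_gt0.
rewrite lt_min => /andP[/h1 ad]; rewrite ltr_pdivlMr // => hy; split=> //.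
apply: le_lt_trans (hK y) _; have := normr_ge0 (y - x); move: hy; rewrite /v; lra.
Qed.

Variable xb : V.

(* A single witness that is valid on a whole ball around [d] when there is one:
   uniformity over a ball is what lets a countable set serve all points of its
   closure. *)
Lemma uniform_witness : exists W : seq nat -> V -> nat -> seq entry, forall s d j,
  (exists l, forall x, `|x - d| < j.+1%:R^-1 -> infeasible s x l) ->
  forall x, `|x - d| < j.+1%:R^-1 -> infeasible s x (W s d j).
Proof.
have /choice[W hW] : forall z : seq nat * V * nat, exists l,
    (exists l, forall x, `|x - z.1.2| < z.2.+1%:R^-1 -> infeasible z.1.1 x l) ->
    forall x, `|x - z.1.2| < z.2.+1%:R^-1 -> infeasible z.1.1 x l.
  move=> z; have [[l hl]|n] := pselect (exists l, forall x,
    `|x - z.1.2| < z.2.+1%:R^-1 -> infeasible z.1.1 x l); first by exists l.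
  by exists [::].
by exists (fun s d j => W (s, d, j)) => s d j; exact: (hW (s, d, j)).
Qed.

Section Closure.
Variable W : seq nat -> V -> nat -> seq entry.

(** Decodes an operation: a rational combination of two arguments, or the [i]-th point of the
    witness for the ball with center the first argument and radius [j.+1%:R^-1]. Terms over these
    operations form a countable type, so one evaluation yields a countable set stable under both. *)
Definition closure_op (n : nat) (vs : seq V) : V :=
  match unpickle n : option (rat + (seq nat * nat * nat)) with
  | Some (inl a) => ratr a *: nth 0 vs 0 + nth 0 vs 1
  | Some (inr (s, j, i)) => nth 0 [seq z.2 | z <- W s (nth 0 vs 0) j] i
  | None => 0
  end.

Fixpoint closure_eval (t : GenTree.tree nat) : V :=
  match t with
  | GenTree.Leaf _ => xb
  | GenTree.Node n ts => closure_op n (map closure_eval ts)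
  end.

Definition closure_space : set V :=
  [set x | forall e : R, 0 < e -> exists t, `|x - closure_eval t| < e].

Lemma closure_eval_in t : closure_space (closure_eval t).
Proof. by move=> e e0; exists t; rewrite subrr normr0. Qed.

Lemma closure_eval_comb (a : rat) t1 t2 : exists t,
  closure_eval t = ratr a *: closure_eval t1 + closure_eval t2.
Proof.
exists (GenTree.Node (pickle (inl a : rat + (seq nat * nat * nat))) [:: t1; t2]).
by rewrite /= /closure_op pickleK.
Qed.

Lemma closure_eval_wit s t j z : z \in W s (closure_eval t) j ->
  exists t', closure_eval t' = z.2.
Proof.
move=> zW; pose i := index z (W s (closure_eval t) j).
exists (GenTree.Node (pickle (inr (s, j, i) : rat + (seq nat * nat * nat))) [:: t]).
rewrite /= /closure_op pickleK /= (nth_map z) ?index_mem //.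
by rewrite nth_index.
Qed.

Lemma closure_space_subspace : Defs.subspace closure_space.
Proof.
split=> [|a u v Mu Mv e e0].
  have [t ht] := closure_eval_comb (- 1) (GenTree.Leaf 0%N) (GenTree.Leaf 0%N).
  have -> : 0 = closure_eval t by rewrite ht rmorphN rmorph1 scaleN1r addNr.
  exact: closure_eval_in.
have e30 : 0 < e / 3 by rewrite divr_gt0.
have u1 : 0 < `|u| + 1 by rewrite ltr_wpDl.
pose d := Num.min 1 (e / 3 / (`|u| + 1)).
have d0 : 0 < d by rewrite lt_min ltr01 divr_gt0.
have [r] : exists r : rat, ratr r \in `]a, a + d[ by apply: rat_in_itvoo; rewrite ltrDl.
rewrite in_itv /= => /andP[ar rd].
have [d1 d2] : d <= 1 /\ d <= e / 3 / (`|u| + 1) by rewrite !ge_min !lexx orbT.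
have r1 : `|ratr r : R| < `|a| + 1.
  rewrite ltr_norml; have := ler_norm a; have := ler_norm (- a).
  by rewrite normrN; lra.
have r0 : 0 < `|a| + 1 by rewrite ltr_wpDl.
have [t1 h1] := Mu _ (divr_gt0 e30 r0); have [t2 h2] := Mv _ e30.
have [t ht] := closure_eval_comb r t1 t2; exists t; rewrite ht.
have -> : a *: u + v - (ratr r *: closure_eval t1 + closure_eval t2) =
   (a - ratr r) *: u + ratr r *: (u - closure_eval t1) + (v - closure_eval t2).
  by rewrite scalerBl scalerBr [X in _ = X + _]addrA subrK opprD addrACA.
have k1 : `|(a - ratr r) *: u| <= e / 3.
  rewrite normrZ; apply: (@le_trans _ _ (d * (`|u| + 1))); last by rewrite -ler_pdivlMr.
  by apply: ler_pM => //; [rewrite ler_norml; lra|rewrite lerDl].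
have k2 : `|ratr r *: (u - closure_eval t1)| <= e / 3.
  rewrite normrZ; apply: (@le_trans _ _ ((`|a| + 1) * (e / 3 / (`|a| + 1)))).
    by apply: ler_pM => //; exact: ltW.
  by rewrite mulrC divfK ?gt_eqF.
have := ler_normD ((a - ratr r) *: u + ratr r *: (u - closure_eval t1)) (v - closure_eval t2).
have := ler_normD ((a - ratr r) *: u) (ratr r *: (u - closure_eval t1)); lra.
Qed.

Lemma closure_space_separable : separable_in closure_space.
Proof.
exists (fun n => if unpickle n is Some t then closure_eval t else xb); split.
  by move=> n; case: unpickle => [t|]; [|apply: (closure_eval_in (GenTree.Leaf 0%N))];
     exact: closure_eval_in.
move=> m Mm e /Mm[t ht]; exists (pickle t); by rewrite pickleK.
Qed.

Lemma closure_space_closed : seq_closed closure_space.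
Proof.
move=> u l Mu ul e e0; have e20 : 0 < e / 2 by rewrite divr_gt0.
have [N hN] := ul _ e20; have [t ht] := Mu N _ e20; exists t.
have := ler_normD (l - u N) (u N - closure_eval t); rewrite addrA subrK.
have := hN N (leqnn _); rewrite distrC; lra.
Qed.

End Closure.

(** If the constraints at [x], with radii read off from [f], were inconsistent with [q], then some
    certificate would have all its points in [M]. There [f] satisfies the constraints and
    [- f <= q], so the certificate contradicts itself. *)
Lemma separable_reduction : exists M : set V,
  [/\ Defs.subspace M, separable_in M, seq_closed M, M xb &
   forall x f, M x -> A x -> dual_on M f -> (forall h, M h -> - f h <= q h) ->
     (forall eps, 0 < eps -> exists2 delta, 0 < delta & forall u, A u -> M u ->
       `|u - x| <= delta -> f (u - x) <= eps * `|u - x|) ->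
   exists xs, frechet_normal (@nrm R V) A x xs /\ forall h, - xs h <= q h].
Proof.
have [W hW] := uniform_witness; pose M := closure_space W.
have sM := closure_space_subspace W.
exists M; split=> //; [exact: closure_space_separable|exact: closure_space_closed|
  exact: (closure_eval_in W (GenTree.Leaf 0%N))|].
move=> x f Mx Ax df fq fn.
have /choice[n hn] : forall k : nat, exists n : nat, forall u, A u -> M u ->
    `|u - x| < n.+1%:R^-1 -> f (u - x) <= k.+1%:R^-1 * `|u - x|.
  move=> k; have [dl dl0 hd] := fn _ (inv_succ_gt0 R k).
  have [m hm] := exists_inv_lt dl0; exists m => u Au Mu um; apply: hd => //.
  exact: ltW (lt_trans um hm).
have feasible l : admissible n x l -> 0 <= q (cone_vec x l) + cone_cost x l.
  move=> adm; rewrite leNgt; apply/negP => neg.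
  pose K := (\max_(z <- l) z.1.1).+1; pose s := mkseq n K.
  have nthE k : (k < K)%N -> nth 0%N s k = n k by move=> ?; rewrite nth_mkseq.
  have [rho rho0 hrho] : exists2 rho : R, 0 < rho & forall y, `|y - x| < rho -> infeasible s y l.
    have lK z : z \in l -> (z.1.1 < K)%N by move=> zl; rewrite ltnS; apply: leq_bigmax_seq.
    apply: infeasible_open; split=> // [|z zl]; last by rewrite nthE ?lK //; exact: adm.
    by apply/allP => z /lK; rewrite size_mkseq.
  (* With radius below [rho / 2], the ball about a nearby term contains [x] and lies where the
     certificate is valid, so the stored witness is valid at [x]. *)
  have [j hj] := exists_inv_lt (divr_gt0 rho0 (ltr0n R 2)).
  have [t ht] := Mx _ (inv_succ_gt0 R j).
  have [/allP sl' adm' neg'] : infeasible s x (W s (closure_eval W t) j).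
    apply: hW => //; exists l => y hy; apply: hrho.
    have := ler_normD (y - closure_eval W t) (closure_eval W t - x).
    rewrite addrA subrK [ `|closure_eval W t - x| ]distrC => /le_lt_trans; apply.
    move: hy ht hj; move: (j.+1%:R^-1) => jj; lra.
  set l' := W s _ j in sl' adm' neg'.
  have Ml z : z \in l' -> M z.2.
    by move=> /closure_eval_wit[t' <-]; exact: closure_eval_in.
  have key : forall l2 : seq entry, (forall z, z \in l2 -> z \in l') ->
      M (cone_vec x l2) /\ f (cone_vec x l2) <= cone_cost x l2.
    elim=> [|z l2 IH] h2.
      rewrite /cone_vec /cone_cost !big_nil (dual_on0 sM df) lexx.
      by split=> //; exact: sM.1.
    have [|M2 f2] := IH; first by move=> z' z'l; apply: h2; rewrite inE z'l orbT.
    have zl := h2 z (mem_head _ _); have Mz := subspaceB sM (Ml _ zl) Mx.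
    have [t0 Az zx] := adm' _ zl.
    rewrite /cone_vec /cone_cost !big_cons -/(cone_vec x l2) -/(cone_cost x l2).
    split; first exact: sM.2.
    rewrite df.1 // lerD // -mulrA ler_wpM2l //.
    apply: hn => //; first exact: Ml.
    by move: zx; rewrite nthE //; have := sl' _ zl; rewrite size_mkseq.
  have [M1 f1] := key l' (fun z h => h).
  by have := fq _ M1; lra.
pose G c r := exists l, [/\ admissible n x l, c = cone_vec x l & r = cone_cost x l].
have cG : convex_cone_rel G.
  split.
  - by exists [::]; rewrite /cone_vec /cone_cost !big_nil; split.
  - move=> _ _ _ _ [l [al -> ->]] [l' [al' -> ->]]; exists (l ++ l').
    rewrite /cone_vec /cone_cost !big_cat; split=> // z.
    by rewrite mem_cat => /orP[/al|/al'].
  - move=> t _ _ t0 [l [al -> ->]]; exists [seq (z.1.1, t * z.1.2, z.2) | z <- l].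
    split=> [z /mapP[z' /al[t0' Az' zz'] ->]||]; first by split=> //=; exact: mulr_ge0.
      rewrite /cone_vec big_map scaler_sumr; apply: eq_bigr => z _.
      by rewrite scalerA.
    rewrite /cone_cost big_map mulr_sumr; apply: eq_bigr => z _ /=.
    by rewrite !mulrA.
have pG c r : G c r -> 0 <= q c + r by move=> [l [al -> ->]]; exact: feasible.
have [y [ly yq yG]] := Hahn_Banach_cone sq cG pG.
have lN : linear_form (fun h => - y h) by move=> a u v; rewrite ly opprD mulrN.
exists (fun h => - y h); split; last by move=> h; rewrite opprK.
split=> //; split.
  apply: (linear_form_is_dual (C := C)) => // h; rewrite -linear_formN //.
  by apply: le_trans (yq _) _; rewrite -[ `|h| ]normrN.
move=> eps eps0; have [k hk] := exists_inv_lt eps0.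
exists (n k).+1%:R^-1; split; first exact: inv_succ_gt0.
move=> u Au; rewrite /nrm => ux.
apply: (@le_trans _ _ (k.+1%:R^-1 * `|u - x|)); last by rewrite ler_wpM2r // ltW.
have := yG (u - x) (k.+1%:R^-1 * `|u - x|); rewrite lerNl; apply.
exists [:: (k, 1, u)]; rewrite /cone_vec /cone_cost !big_seq1 scale1r mul1r.
by split=> // z; rewrite inE => /eqP ->.
Qed.

End SeparableReduction.

(** The condition of [asplund] on a plain normed space, so that it can be stated for products;
    completeness is carried separately by [seq_complete]. *)
Definition asplund_space (R : realType) (V : normedModType R) : Prop :=
  forall M : set V, Defs.subspace M -> separable_in M -> separable_dual M.

(** The subspace is built for the bound [N + mu * |.|] rather than [N], since this is the bound that
    the rule inside the subspace delivers. *)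
Lemma fuzzy_rule (R : realType) (V : normedModType R) (A : set V) (N : V -> R)
    (C rho mu : R) (xb : V) :
  seq_complete V -> asplund_space V -> seq_closed A ->
  sublinear N -> (forall x, N x <= C * `|x|) -> 0 < C -> 0 < rho -> 0 < mu ->
  A xb -> (forall x, A x -> `|x - xb| <= rho -> 0 <= N (x - xb)) ->
  exists x xs, [/\ A x, `|x - xb| <= mu, frechet_normal (@nrm R V) A x xs &
                   forall h, - xs h <= N h + mu * `|h|].
Proof.
move=> cV aV clA sN NC C0 r0 m0 Axb xmin.
have s1 : sublinear (fun h => N h + mu * `|h|).
  apply: sublinear_add => //; split=> [u v|t u t0].
    by rewrite -mulrDr ler_pM2l // ler_normD.
  by rewrite normrZ ger0_norm // mulrCA.
have b1 h : N h + mu * `|h| <= (C + mu) * `|h| by have := NC h; lra.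
have [M [sM sepM clM Mxb red]] := separable_reduction A s1 b1 (addr_gt0 C0 m0) xb.
have [|x [f [[Ax Mx xxb] [df fN fn]]]] := separable_fuzzy_rule cV sM clM sepM
  (aV _ sM sepM) clA sN NC C0 r0 m0 Axb Mxb; first by move=> y Ay _; exact: xmin.
have [xs [nxs xsN]] := red _ _ Mx Ax df fN fn.
by exists x, xs.
Qed.

(** * Products of Asplund spaces *)

Section Products.
Variables (R : realType).
Implicit Types (V W : normedModType R).

Lemma prod_norm_le V W (z : V * W) c : (`|z| <= c) = (`|z.1| <= c) && (`|z.2| <= c).
Proof. by rewrite prod_normE ge_max. Qed.

Lemma prod_norm_fst V W (z : V * W) : `|z.1| <= `|z|.
Proof. by have := lexx `|z|; rewrite {1}prod_norm_le => /andP[]. Qed.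

Lemma prod_norm_snd V W (z : V * W) : `|z.2| <= `|z|.
Proof. by have := lexx `|z|; rewrite {1}prod_norm_le => /andP[]. Qed.

Lemma prod_norm_le_add V W (z : V * W) : `|z| <= `|z.1| + `|z.2|.
Proof. by rewrite prod_norm_le lerDl lerDr !normr_ge0. Qed.

Lemma conv_fst V W (u : nat -> V * W) l : conv u l -> conv (fun n => (u n).1) l.1.
Proof.
move=> ul e /ul[N hN]; exists N => n /hN; apply: le_trans.
exact: (prod_norm_fst (u n - l)).
Qed.

Lemma conv_snd V W (u : nat -> V * W) l : conv u l -> conv (fun n => (u n).2) l.2.
Proof.
move=> ul e /ul[N hN]; exists N => n /hN; apply: le_trans.
exact: (prod_norm_snd (u n - l)).
Qed.

Lemma conv_pair V W (u : nat -> V * W) l :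
  conv (fun n => (u n).1) l.1 -> conv (fun n => (u n).2) l.2 -> conv u l.
Proof.
move=> h1 h2 e e0; have [N1 k1] := h1 _ e0; have [N2 k2] := h2 _ e0.
exists (maxn N1 N2) => n; rewrite geq_max => /andP[n1 n2].
by rewrite prod_norm_le; apply/andP; split; [exact: k1|exact: k2].
Qed.

Lemma seq_complete_prod V W :
  seq_complete V -> seq_complete W -> seq_complete (V * W)%type.
Proof.
move=> cV cW u cu.
have [|l1 h1] := cV (fun n => (u n).1).
  move=> e /cu[N hN]; exists N => n m Nn Nm; apply: le_trans (hN _ _ Nn Nm).
  exact: (prod_norm_fst (u n - u m)).
have [|l2 h2] := cW (fun n => (u n).2).
  move=> e /cu[N hN]; exists N => n m Nn Nm; apply: le_trans (hN _ _ Nn Nm).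
  exact: (prod_norm_snd (u n - u m)).
by exists (l1, l2); exact: conv_pair.
Qed.

Lemma dual_on_extend V (M : set V) (f : V -> R) : Defs.subspace M -> dual_on M f ->
  exists F C, [/\ linear_form F, forall x, F x <= C * `|x|, 0 <= C &
                  forall m, M m -> F m = f m].
Proof.
move=> sM df; have [_ [C0 hC0]] := df; pose C := `|C0|.
have C_ge0 : 0 <= C := normr_ge0 C0.
have hC m : M m -> `|f m| <= C * `|m|.
  by move=> /hC0 /le_trans; apply; rewrite ler_wpM2r // ler_norm.
have sp : sublinear (fun x : V => C * `|x|).
  split=> [u v|t u t0]; first by rewrite -mulrDr; apply: ler_wpM2l => //; exact: ler_normD.
  by rewrite normrZ ger0_norm // mulrCA.
pose G c r := M c /\ r = - f c.
have cG : convex_cone_rel G.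
  split.
  - by split; [exact: sM.1|rewrite (dual_on0 sM df) oppr0].
  - move=> u _ v _ [Mu ->] [Mv ->]; split; first exact: subspaceD.
    by rewrite (dual_onD df) // opprD.
  - move=> t u _ t0 [Mu ->]; split; first exact: subspaceZ.
    by rewrite (dual_onZ sM _ df) // mulrN.
have pG c r : G c r -> 0 <= C * `|c| + r.
  by move=> [Mc ->]; have := hC _ Mc; rewrite ler_norml; lra.
have [F [lF Fp FG]] := Hahn_Banach_cone sp cG pG.
exists F, C; split=> // m Mm.
have Gm : G m (- f m) by [].
have GN : G (- m) (f m) by split; [exact: subspaceN|rewrite (dual_onN sM df) ?opprK].
have := FG _ _ Gm; have := FG _ _ GN; rewrite linear_formN // opprK => h1 h2.
by apply/eqP; rewrite eq_le h2 andbT; lra.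
Qed.

(** A functional on [M] need not act on the projections of [M], as [(x, 0)] may lie outside [M]. Its
    Hahn-Banach extension splits into two partial functionals, which are approximated on the two
    projections separately. *)
Lemma asplund_prod V W :
  asplund_space V -> asplund_space W -> asplund_space (V * W)%type.
Proof.
move=> aV aW M sM [d [Md dd]].
pose M1 : set V := [set x | exists y, M (x, y)].
pose M2 : set W := [set y | exists x, M (x, y)].
have s1 : Defs.subspace M1.
  split=> [|a u v [u' Mu] [v' Mv]]; first by exists 0; exact: sM.1.
  by exists (a *: u' + v'); exact: (sM.2 a _ _ Mu Mv).
have s2 : Defs.subspace M2.
  split=> [|a u v [u' Mu] [v' Mv]]; first by exists 0; exact: sM.1.
  by exists (a *: u' + v'); exact: (sM.2 a _ _ Mu Mv).
have sep1 : separable_in M1.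
  exists (fun n => (d n).1); split=> [n|m [y My] e /(dd _ My)[n hn]].
    by exists (d n).2; rewrite -surjective_pairing.
  by exists n; apply: le_lt_trans hn; exact: (prod_norm_fst ((m, y) - d n)).
have sep2 : separable_in M2.
  exists (fun n => (d n).2); split=> [n|m [y My] e /(dd _ My)[n hn]].
    by exists (d n).1; rewrite -surjective_pairing.
  by exists n; apply: le_lt_trans hn; exact: (prod_norm_snd ((y, m) - d n)).
have [f1 [df1 hf1]] := aV _ s1 sep1; have [f2 [df2 hf2]] := aW _ s2 sep2.
have in1 z : M z -> M1 z.1 by exists z.2; rewrite -surjective_pairing.
have in2 z : M z -> M2 z.2 by exists z.1; rewrite -surjective_pairing.
exists (fun n z => let ij := odflt (0%N, 0%N) (unpickle n) in f1 ij.1 z.1 + f2 ij.2 z.2).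
split=> [n|f df e e0].
  set ij := odflt _ _; have [l1 [C1 b1]] := df1 ij.1; have [l2 [C2 b2]] := df2 ij.2.
  split=> [a u v Mu Mv /=|].
    by rewrite l1 ?l2; [ring|exact: in2|exact: in2|exact: in1|exact: in1].
  exists (`|C1| + `|C2|) => m Mm /=.
  apply: le_trans (ler_normD _ _) _; rewrite mulrDl; apply: lerD.
    apply: le_trans (b1 _ (in1 _ Mm)) _; apply: le_trans (ler_norm _) _.
    by rewrite normrM normr_id; apply: ler_wpM2l => //; exact: prod_norm_fst.
  apply: le_trans (b2 _ (in2 _ Mm)) _; apply: le_trans (ler_norm _) _.
  by rewrite normrM normr_id; apply: ler_wpM2l => //; exact: prod_norm_snd.
have [F [C [lF FC C0 Ff]]] := dual_on_extend sM df.
have d1 : dual_on M1 (fun x => F (x, 0)).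
  apply: (@linear_dual_on _ _ _ _ C) => [a u v|x].
    by rewrite -lF; congr F; apply: injective_projections => /=; rewrite ?scaler0 ?addr0.
  apply: le_trans (FC _) _; apply: ler_wpM2l => //.
  by rewrite prod_norm_le /= lexx normr0 normr_ge0.
have d2 : dual_on M2 (fun y => F (0, y)).
  apply: (@linear_dual_on _ _ _ _ C) => [a u v|x].
    by rewrite -lF; congr F; apply: injective_projections => /=; rewrite ?scaler0 ?addr0.
  apply: le_trans (FC _) _; apply: ler_wpM2l => //.
  by rewrite prod_norm_le /= lexx normr0 normr_ge0.
have e20 : 0 < e / 2 by rewrite divr_gt0.
have [i hi] := hf1 _ d1 _ e20; have [j hj] := hf2 _ d2 _ e20.
exists (pickle (i, j)) => m Mm; rewrite pickleK /=.
have -> : f m = F (m.1, 0) + F (0, m.2).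
  rewrite -linear_formD // -Ff //; congr F.
  by apply: injective_projections => /=; rewrite ?addr0 ?add0r.
rewrite opprD addrACA; apply: le_trans (ler_normD _ _) _.
have := hi _ (in1 _ Mm); have := hj _ (in2 _ Mm).
have : e / 2 * `|m.1| <= e / 2 * `|m| by rewrite ler_pM2l // prod_norm_fst.
have : e / 2 * `|m.2| <= e / 2 * `|m| by rewrite ler_pM2l // prod_norm_snd.
lra.
Qed.

Lemma asplund_real : asplund_space (R^o : normedModType R).
Proof.
move=> M sM _.
exists (fun n x => ratr (odflt 0 (unpickle n : option rat)) * x); split.
  move=> n; set r := odflt _ _; split=> [a u v _ _|]; first by rewrite /= /GRing.scale /=; ring.
  by exists `|ratr r : R| => m _; rewrite normrM.
move=> f df e e0.
have [[m Mm m0]|nm] := pselect (exists2 m, M m & m != 0).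
  have fE x : M x -> f x = f m / m * x.
    move=> Mx; have := dual_onZ sM (x / m) df Mm.
    by rewrite /GRing.scale /= divfK // => ->; field.
  have [r] : exists r : rat, ratr r \in `](f m / m), (f m / m + e)[.
    by apply: rat_in_itvoo; rewrite ltrDl.
  rewrite in_itv /= => /andP[r1 r2]; exists (pickle r) => x Mx.
  rewrite pickleK /= fE // -mulrBl normrM ler_wpM2r // ler_norml; lra.
exists 0%N => m Mm; have -> : m = 0.
  by apply/eqP; apply/negPn/negP => m0; apply: nm; exists m.
by rewrite mulr0 subr0 (dual_on0 sM df) !normr0 mulr0.
Qed.

Lemma closed_seq_closed V (A : set V) : closed A -> seq_closed A.
Proof.
move=> cA u l Au /convP ul; apply: (closed_cvg A cA _ _ ul).
by exists 0%N => // n _ /=; exact: Au.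
Qed.

(** Passing to a larger norm shrinks the balls and relaxes the bound; this takes normals from the
    max norm to the sum norm. *)
Lemma frechet_normal_norm V (n : V -> R) (A : set V) x xs :
  (forall v, `|v| <= n v) -> frechet_normal (@nrm R V) A x xs ->
  frechet_normal n A x xs.
Proof.
move=> hn [Ax [dx h]]; split=> //; split=> // e e0.
have [d [d0 hd]] := h _ e0; exists d; split=> // u Au ud.
apply: le_trans (hd _ Au _) _; first exact: le_lt_trans (hn _) ud.
by rewrite ler_pM2l //; exact: hn.
Qed.

(** Serves to drop the ball constraint that is added to an epigraph to make it closed. *)
Lemma frechet_normal_local V (A B : set V) x xs r : 0 < r -> B x ->
  (forall u, B u -> `|u - x| < r -> A u) ->
  frechet_normal (@nrm R V) A x xs -> frechet_normal (@nrm R V) B x xs.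
Proof.
move=> r0 Bx BA [Ax [dx h]]; split=> //; split=> // e e0.
have [d [d0 hd]] := h _ e0; exists (Num.min d r); split; first by rewrite lt_min d0.
move=> u Bu; rewrite lt_min => /andP[ud ur]; apply: hd => //; exact: BA.
Qed.

Lemma is_dual_linear V (f : V -> R) : is_dual f -> linear_form f.
Proof. by move=> [h _] a u v; exact: h. Qed.

Lemma frechet_normal_fst V W (A : set V) (B : set W) z xs :
  frechet_normal (@nrm R (V * W)%type) [set z | A z.1 /\ B z.2] z xs ->
  frechet_normal (@nrm R V) A z.1 (fun h => xs (h, 0)).
Proof.
move=> [[Az Bz] [dx h]]; split=> //; have lx := is_dual_linear dx; split.
  split=> [a u v|].
    by rewrite -lx; congr xs; apply: injective_projections => /=; rewrite ?scaler0 ?addr0.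
  move=> x; apply: (@continuous_comp _ _ _ (fun h : V => (h, 0 : W)) xs); last exact: dx.2.
  by apply: cvg_pair; [exact: cvg_id|exact: cvg_cst].
move=> e e0; have [d [d0 hd]] := h _ e0; exists d; split=> // u Au.
have E : (u, z.2) - z = (u - z.1, 0).
  by apply: injective_projections => /=; rewrite ?subrr.
have E2 : @nrm R (V * W)%type ((u, z.2) - z) = @nrm R V (u - z.1).
  by rewrite E /nrm prod_normE /= normr0 max_l.
by rewrite -E2 -E => ud; apply: hd.
Qed.

Lemma frechet_normal_snd V W (A : set V) (B : set W) z xs :
  frechet_normal (@nrm R (V * W)%type) [set z | A z.1 /\ B z.2] z xs ->
  frechet_normal (@nrm R W) B z.2 (fun h => xs (0, h)).
Proof.
move=> [[Az Bz] [dx h]]; split=> //; have lx := is_dual_linear dx; split.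
  split=> [a u v|].
    by rewrite -lx; congr xs; apply: injective_projections => /=; rewrite ?scaler0 ?addr0.
  move=> x; apply: (@continuous_comp _ _ _ (fun h : W => (0 : V, h)) xs); last exact: dx.2.
  by apply: cvg_pair; [exact: cvg_cst|exact: cvg_id].
move=> e e0; have [d [d0 hd]] := h _ e0; exists d; split=> // u Bu.
have E : (z.1, u) - z = (0, u - z.2).
  by apply: injective_projections => /=; rewrite ?subrr.
have E2 : @nrm R (V * W)%type ((z.1, u) - z) = @nrm R W (u - z.2).
  by rewrite E /nrm prod_normE /= normr0 max_r.
by rewrite -E2 -E => ud; apply: hd.
Qed.

End Products.

(** * Weak* sequential compactness *)

Lemma subsequence_choice (P : nat -> nat -> Prop) :
  (forall k N, exists2 n, (N <= n)%N & P k n) ->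
  exists phi : nat -> nat, (forall k, (phi k < phi k.+1)%N) /\ forall k, P k (phi k).
Proof.
move=> h; have /choice[sel hsel] : forall z : nat * nat, exists n, (z.2 <= n)%N /\ P z.1 n.
  by move=> [k N]; have [n] := h k N; exists n.
pose phi := fix phi k := if k is k'.+1 then sel (k, (phi k').+1) else sel (0%N, 0%N).
exists phi; split=> k; first by have [] := hsel (k.+1, (phi k).+1).
by case: k => [|k]; [have [] := hsel (0%N, 0%N)|have [] := hsel (k.+1, (phi k).+1)].
Qed.

Lemma subsequence_ge (phi : nat -> nat) :
  (forall k, (phi k < phi k.+1)%N) -> forall k, (k <= phi k)%N.
Proof. by move=> h; elim=> // k IH; exact: leq_ltn_trans IH (h k). Qed.

Lemma real_limsup (R : realType) (u : nat -> R) B : (forall n, `|u n| <= B) ->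
  exists l, (forall e, 0 < e -> exists N, forall n, (N <= n)%N -> u n <= l + e) /\
            (forall e N, 0 < e -> exists2 n, (N <= n)%N & l - e <= u n).
Proof.
move=> uB; pose S := [set b | exists N, forall n, (N <= n)%N -> u n <= b].
have hi : has_inf S.
  split; first by exists B, 0%N => n _; have := uB n; rewrite ler_norml => /andP[].
  exists (- B) => b [N /(_ _ (leqnn _))]; apply: le_trans.
  by have := uB N; rewrite ler_norml => /andP[].
exists (inf S); split=> [e e0|e N e0].
  have [b [N hN] hb] := inf_adherent e0 hi; exists N => n /hN /le_trans; apply.
  exact: ltW.
apply: contrapT => no; have : inf S <= inf S - e.
  apply: ge_inf; first by case: hi.
  exists N => n Nn; rewrite leNgt; apply/negP => h.
  by apply: no; exists n => //; exact: ltW.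
by rewrite leNgt ltrBlDr ltrDl e0.
Qed.

(* The hypograph of [limsup f_n] has a Frechet normal with positive last
   component, so the limsup is superdifferentiable at some [x]; a subsequence
   along which [f_n x] tends to the limsup then converges pointwise. *)
Lemma weak_star_seq_compact (R : realType) (V : normedModType R)
    (f : nat -> V -> R) (C : R) :
  seq_complete V -> asplund_space V -> 0 < C ->
  (forall n, linear_form (f n)) -> (forall n h, f n h <= C * `|h|) ->
  exists (phi : nat -> nat) (g : V -> R), [/\ forall k, (phi k < phi k.+1)%N,
    linear_form g, forall h, g h <= C * `|h| &
    forall h e, 0 < e -> exists N, forall n, (N <= n)%N -> `|f (phi n) h - g h| <= e].
Proof.
move=> cV aV C0 lf fC.
have fabs n h : `|f n h| <= C * `|h|.
  rewrite ler_norml fC andbT lerNl -linear_formN //.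
  by apply: le_trans (fC _ _) _; rewrite normrN.
have /choice[p hp] h := real_limsup (fun n => fabs n h).
have p1 h e : 0 < e -> exists N, forall n, (N <= n)%N -> f n h <= p h + e.
  exact: (hp h).1.
have p2 h e N : 0 < e -> exists2 n, (N <= n)%N & p h - e <= f n h.
  exact: (hp h).2.
have plip x y : p y <= p x + C * `|y - x|.
  apply/ler_addgt0Pr => e e0; have e20 : 0 < e / 2 by rewrite divr_gt0.
  have [N hN] := p1 x _ e20; have [n Nn hn] := p2 y _ N e20.
  have := hN _ Nn; have := fC n (y - x); rewrite linear_formB //; lra.
have p0 : 0 <= p 0.
  apply/ler_addgt0Pr => e e0; have [N hN] := p1 0 _ e0.
  by have := hN _ (leqnn _); rewrite linear_form0.
have pC h : p h <= C * `|h|.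
  apply/ler_addgt0Pr => e e0; have [n _ hn] := p2 h _ 0%N e0.
  by have := fC n h; lra.
pose W := (V * R^o)%type.
pose A : set W := [set z | z.2 <= p z.1].
have clA : seq_closed A.
  move=> u l Au ul; rewrite /A /=; apply/ler_addgt0Pr => e e0.
  have C10 : 0 < C + 1 by rewrite ltr_wpDl // ltW.
  have [N hN] := ul _ (divr_gt0 e0 C10); have := hN _ (leqnn _).
  rewrite ler_pdivlMr // => h; have := Au N; rewrite /A /=.
  have a1 : C * `|(u N).1 - l.1| <= C * `|u N - l|.
    by rewrite ler_pM2l //; exact: (prod_norm_fst (u N - l)).
  have a2 : `|(u N).2 - l.2| <= `|u N - l| by exact: (prod_norm_snd (u N - l)).
  have := plip l.1 (u N).1; move: a2; rewrite ler_norml; lra.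
(* Since [p h <= C * |h|], this functional is nonnegative on the hypograph, and the origin is the
   minimum required by the rule. *)
pose N (z : W) : R := - z.2 + C * `|z.1|.
have sN : sublinear N.
  split=> [u v|t u t0]; rewrite /N /=.
    have : C * `|u.1 + v.1| <= C * (`|u.1| + `|v.1|) by rewrite ler_pM2l // ler_normD.
    lra.
  by rewrite normrZ ger0_norm // /GRing.scale /=; ring.
have NC z : N z <= (1 + C) * `|z|.
  have : C * `|z.1| <= C * `|z| by rewrite ler_pM2l // prod_norm_fst.
  have := prod_norm_snd z; rewrite /N ler_norml; lra.
have A0 : A 0 by exact: p0.
have min0 z : A z -> `|z - 0| <= 1 -> 0 <= N (z - 0).
  by rewrite subr0 /A /N /= => h _; have := pC z.1; lra.
have h2 : 0 < 2^-1 :> R by rewrite invr_gt0.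
have [|[x t] [xs [Ax _ [_ [dx nx]] xsN]]] := fuzzy_rule (seq_complete_prod cV (@realtype_seq_complete R))
  (asplund_prod aV (@asplund_real R)) clA sN NC _ ltr01 h2 A0 min0.
  by rewrite addr_gt0.
have lx := is_dual_linear dx.
(* The slope of [N] in the vertical direction is [-1] and the error is [1 / 2], so [lam >= 1 / 2]
   and the normal is not horizontal. *)
pose lam := xs (0, 1).
have lam0 : 0 < lam.
  have := xsN (0, 1); rewrite /N /= normr0 -/lam.
  have : `|((0, 1) : W)| <= 1 by rewrite prod_norm_le /= normr0 normr1 ler01 lexx.
  lra.
have xsE h (s : R) : xs (h, s) = xs (h, 0) + s * lam.
  rewrite /lam -linear_formZ // -linear_formD //; congr xs.
  by apply: injective_projections; rewrite /= ?scaler0 ?addr0 // add0r /GRing.scale /= mulr1.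
pose g h := - xs (h, 0) / lam.
have lg : linear_form g.
  move=> a u v; rewrite /g; have -> : xs (a *: u + v, 0) = a * xs (u, 0) + xs (v, 0).
    rewrite -lx; congr xs.
    by apply: injective_projections; rewrite /= ?scaler0 ?addr0.
  by field; rewrite gt_eqF.
have pd e : 0 < e -> exists2 d, 0 < d & forall h, `|h| <= d -> p (x + h) - p x <= g h + e * `|h|.
  move=> e0; have C10 : 0 < C + 1 by rewrite ltr_wpDl // ltW.
  have [d [d0 hd]] := nx _ (divr_gt0 (mulr_gt0 e0 lam0) C10).
  exists (d / (2 * (C + 1))) => [|h]; first by rewrite divr_gt0 // mulr_gt0.
  rewrite ler_pdivlMr ?mulr_gt0 // => hh.
  pose u : W := (x + h, t + (p (x + h) - p x)).
  have Au : A u by move: Ax; rewrite /A /u /=; lra.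
  have uE : u - (x, t) = (h, p (x + h) - p x).
    by apply: injective_projections; rewrite /= addrAC subrr add0r.
  have dp : `|p (x + h) - p x| <= C * `|h|.
    have := plip x (x + h); have := plip (x + h) x.
    rewrite [x + h - x]addrAC subrr add0r opprD addrA subrr add0r normrN ler_norml; lra.
  have un : `|u - (x, t)| <= (C + 1) * `|h|.
    rewrite uE prod_norm_le /=; apply/andP; split.
      by have := mulr_ge0 (ltW C0) (normr_ge0 h); lra.
    by apply: le_trans dp _; have := normr_ge0 h; lra.
  have ud : nrm (u - (x, t)) < d by apply: le_lt_trans un _; lra.
  have := hd u Au ud; rewrite /nrm => hu.
  have : xs (u - (x, t)) <= e * lam * `|h|.
    apply: le_trans hu _; rewrite mulrAC ler_pdivrMr //.
    have : e * lam * `|u - (x, t)| <= e * lam * ((C + 1) * `|h|).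
      by rewrite ler_pM2l // mulr_gt0.
    by move/le_trans; apply; rewrite -[leRHS]mulrA [`|h| * _]mulrC.
  rewrite uE xsE /g => hu2; rewrite -(ler_pM2r lam0) [leRHS]mulrDl divfK ?gt_eqF //; lra.
have [phi [phi_incr hphi]] : exists phi : nat -> nat, (forall k, (phi k < phi k.+1)%N) /\
    forall k, p x - k.+1%:R^-1 <= f (phi k) x.
  apply: (@subsequence_choice (fun k n => p x - k.+1%:R^-1 <= f n x)) => k M.
  exact: p2 _ _ _ (inv_succ_gt0 R k).
(* [s * f n v] is [f n (x + s v) - f n x]: the limsup bounds the first value, the choice of [phi]
   the second, and superdifferentiability compares the two. These are the three errors in
   [e1 * (|v| + 2)]. Linearity at [- v] gives the lower bound. *)
have upper v e : 0 < e -> exists M, forall n, (M <= n)%N -> f (phi n) v <= g v + e.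
  move=> e0; have v0 : 0 < `|v| + 2 by rewrite ltr_wpDl.
  pose e1 := e / (`|v| + 2); have e10 : 0 < e1 by rewrite divr_gt0.
  have [d d0 hd] := pd _ e10; pose s := d / (`|v| + 1).
  have v1 : 0 < `|v| + 1 by rewrite ltr_wpDl.
  have s0 : 0 < s by rewrite divr_gt0.
  have /hd hs : `|s *: v| <= d.
    rewrite normrZ gtr0_norm // /s mulrAC ler_pdivrMr // ler_pM2l //; lra.
  have [N1 h1] := p1 (x + s *: v) _ (mulr_gt0 e10 s0).
  have [N2 hN2] := exists_inv_lt (mulr_gt0 e10 s0).
  exists (maxn N1 N2) => n; rewrite geq_max => /andP[n1 n2].
  have := h1 _ (leq_trans n1 (subsequence_ge phi_incr n)).
  have := hphi n; rewrite linear_formD // linear_formZ // => k1 k2.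
  have k3 : n.+1%:R^-1 <= e1 * s by apply: le_trans (inv_succ_le R n2) (ltW hN2).
  rewrite -(ler_pM2l s0); move: hs; rewrite normrZ gtr0_norm // (linear_formZ _ _ lg).
  have -> : e = e1 * (`|v| + 2) by rewrite /e1 divfK ?gt_eqF.
  move: k1 k3; move: (n.+1%:R^-1) => ii; lra.
have lim v e : 0 < e -> exists M, forall n, (M <= n)%N -> `|f (phi n) v - g v| <= e.
  move=> e0; have [M1 h1] := upper v _ e0; have [M2 h2'] := upper (- v) _ e0.
  exists (maxn M1 M2) => n; rewrite geq_max => /andP[n1 n2].
  have := h1 _ n1; have := h2' _ n2; rewrite (linear_formN _ (lf _)) (linear_formN _ lg) ler_norml; lra.
exists phi, g; split=> // h; apply/ler_addgt0Pr => e e0.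
have [M hM] := lim h _ e0; have := hM _ (leqnn _); have := fC (phi M) h.
by rewrite ler_norml; lra.
Qed.

(** * Limiting subgradients of scalarizations *)

Lemma linear_form_abs (R : realType) (V : normedModType R) (f : V -> R) C :
  linear_form f -> (forall h, f h <= C * `|h|) -> forall h, `|f h| <= C * `|h|.
Proof.
move=> lf fC h; rewrite ler_norml fC andbT lerNl -(linear_formN _ lf).
by apply: le_trans (fC _) _; rewrite normrN.
Qed.

Lemma epi_ball_closed (R : realType) (W : normedModType R) (psi : W -> R) wb r K :
  (forall a b, `|a - wb| <= r -> `|b - wb| <= r -> psi a - psi b <= K * `|a - b|) ->
  seq_closed ([set z : W * R^o | `|z.1 - wb| <= r /\ psi z.1 <= z.2]).
Proof.
move=> lip u l Au ul.
have lr : `|l.1 - wb| <= r.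
  apply/ler_addgt0Pr => e e0; have [N hN] := conv_fst ul e0.
  have := hN _ (leqnn _); have [] := Au N; rewrite distrC.
  have := ler_normD (l.1 - (u N).1) ((u N).1 - wb); rewrite addrA subrK.
  by rewrite [ `|wb - _| ]distrC [ `|l.1 - (u N).1| ]distrC; lra.
split=> //; apply/ler_addgt0Pr => e e0.
have K0 : 0 < `|K| + 1 by rewrite ltr_wpDl.
have [N hN] := ul _ (divr_gt0 e0 K0); have := hN _ (leqnn _).
rewrite ler_pdivlMr // => h; have [hr hpsi] := Au N.
have h1 : `|(u N).1 - l.1| <= `|u N - l| by exact: (prod_norm_fst (u N - l)).
have h2 : `|(u N).2 - l.2| <= `|u N - l| by exact: (prod_norm_snd (u N - l)).
have h3 : K * `|l.1 - (u N).1| <= `|K| * `|u N - l|.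
  rewrite distrC; apply: le_trans (ler_norm _) _; rewrite normrM normr_id.
  exact: ler_wpM2l.
have := lip _ _ lr hr; move: h2; rewrite ler_norml; lra.
Qed.

Section Scalarization.
Variables (R : realType) (W Z : normedModType R) (nW : W -> R) (g : W -> Z) (wb : W).
Hypotheses (cW : seq_complete W) (aW : asplund_space W).
Hypothesis nW_ge : forall v, `|v| <= nW v.
Variables (r Lg : R).
Hypotheses (r_gt0 : 0 < r) (Lg_gt0 : 0 < Lg).
Hypothesis g_lip : forall a b, `|a - wb| <= r -> `|b - wb| <= r ->
  `|g a - g b| <= Lg * `|a - b|.
Hypothesis g_strict : strictly_lipschitz nW g wb.
Variables (zn : nat -> Z -> R) (zs : Z -> R) (an : nat -> W -> R) (a : W -> R).
Variables (w : nat -> W) (Cz Ca : R).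
Hypotheses (lzn : forall n, linear_form (zn n)) (lz : linear_form zs).
Hypotheses (Cz_gt0 : 0 < Cz) (Ca_gt0 : 0 < Ca).
Hypothesis znC : forall n z, zn n z <= Cz * `|z|.
Hypothesis zC : forall z, zs z <= Cz * `|z|.
Hypothesis zn_cvg : forall z e, 0 < e ->
  exists N, forall n, (N <= n)%N -> `|zn n z - zs z| <= e.
Hypotheses (lan : forall n, linear_form (an n)) (la : linear_form a).
Hypothesis anC : forall n h, an n h <= Ca * `|h|.
Hypothesis aC : forall h, a h <= Ca * `|h|.
Hypothesis an_cvg : forall h e, 0 < e ->
  exists N, forall n, (N <= n)%N -> `|an n h - a h| <= e.
Hypothesis w_cvg : conv w wb.
Hypothesis w_near : forall n, `|w n - wb| <= r / 2.
(** This is the Frechet subgradient inequality for [zn n \o g] at [w n]. *)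
Hypothesis an_normal : forall n e, 0 < e -> exists2 d, 0 < d & forall v,
  `|v - wb| <= r -> `|v - w n| <= d ->
  an n (v - w n) - zn n (g v - g (w n)) <= e * `|v - w n|.

Let T := (W * R^o)%type.
Let xi n (z : Z) : R := zn n z - zs z.
Let C2 := 2 * Cz * Lg.
Let C2_gt0 : 0 < C2. Proof. by rewrite /C2 !mulr_gt0. Qed.

Let lxi n : linear_form (xi n).
Proof. by move=> c u v; rewrite /xi lzn lz; ring. Qed.

Let xi_abs n z : `|xi n z| <= 2 * Cz * `|z|.
Proof.
have := linear_form_abs (lzn n) (znC n) z; have := linear_form_abs lz zC z.
by rewrite /xi !ler_norml; lra.
Qed.

Let xi_lip n u v : `|u - wb| <= r -> `|v - wb| <= r ->
  xi n (g u) - xi n (g v) <= C2 * `|u - v|.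
Proof.
move=> hu hv; rewrite -(linear_formB _ _ (lxi n)); apply: le_trans (ler_norm _) _.
apply: le_trans (xi_abs _ _) _; rewrite /C2 -[leRHS]mulrA; apply: ler_wpM2l; last exact: g_lip.
by rewrite mulr_ge0 // ltW.
Qed.

Let zs_lip u v : `|u - wb| <= r -> `|v - wb| <= r ->
  zs (g u) - zs (g v) <= Cz * Lg * `|u - v|.
Proof.
move=> hu hv; rewrite -(linear_formB _ _ lz); apply: le_trans (zC _) _.
by rewrite -[leRHS]mulrA ler_pM2l //; exact: g_lip.
Qed.

Let E1 : set T := [set z | `|z.1 - wb| <= r /\ zs (g z.1) <= z.2].
Let E2 n : set T := [set z | `|z.1 - wb| <= r /\ xi n (g z.1) <= z.2].
(** The cap [r / 4] keeps the perturbed points within [3 / 4 * r] of [wb], leaving room for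
    increments inside the ball where [g] is Lipschitz. *)
Let mu n : R := Num.min n.+1%:R^-1 (r / 4).

Let mu_gt0 n : 0 < mu n.
Proof. by rewrite lt_min inv_succ_gt0 divr_gt0. Qed.
Let mu_le n : mu n <= n.+1%:R^-1. Proof. by rewrite ge_min lexx. Qed.
Let mu_r n : mu n <= r / 4. Proof. by rewrite ge_min lexx orbT. Qed.

Let w_ball n : `|w n - wb| <= r. Proof. by have := w_near n; have := r_gt0; lra. Qed.

(** [zn n \o g] is the sum of [zs \o g] and [xi n \o g]. Giving each summand its own variable is
    exact under the penalty [C2 * |h.1.1 - h.2.1|], because [C2] is a Lipschitz constant of
    [xi n \o g]; the rule then separates the two epigraphs. *)
Lemma decoupled_normals n : exists (z : T * T) (xs : T * T -> R),
  [/\ E1 z.1 /\ E2 n z.2, `|z - ((w n, zs (g (w n))), (w n, xi n (g (w n))))| <= mu n,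
      frechet_normal (@nrm R (T * T)%type) [set z | E1 z.1 /\ E2 n z.2] z xs &
      forall h, - xs h <= h.1.2 + h.2.2 - an n h.1.1 + n.+1%:R^-1 * `|h.1.1|
                          + C2 * `|h.1.1 - h.2.1| + mu n * `|h| ].
Proof.
pose ep : R := n.+1%:R^-1; have ep0 : 0 < ep by exact: inv_succ_gt0.
have ep1 : ep <= 1 by have := inv_succ_le R (leq0n n); rewrite invr1.
pose N (h : T * T) : R :=
  h.1.2 + h.2.2 - an n h.1.1 + ep * `|h.1.1| + C2 * `|h.1.1 - h.2.1|.
have sN : sublinear N.
  split=> [u v|t u t0]; rewrite /N /=.
    rewrite (linear_formD _ _ (lan n)).
    have -> : u.1.1 + v.1.1 - (u.2.1 + v.2.1) = (u.1.1 - u.2.1) + (v.1.1 - v.2.1).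
      by rewrite opprD addrACA.
    have h1 : C2 * `|u.1.1 - u.2.1 + (v.1.1 - v.2.1)| <=
              C2 * (`|u.1.1 - u.2.1| + `|v.1.1 - v.2.1|).
      by rewrite ler_pM2l // ler_normD.
    have h2 : ep * `|u.1.1 + v.1.1| <= ep * (`|u.1.1| + `|v.1.1|).
      by rewrite ler_pM2l // ler_normD.
    lra.
  rewrite (linear_formZ _ _ (lan n)) -scalerBr !normrZ ger0_norm //.
  by rewrite /GRing.scale /=; ring.
pose C := 2 + Ca + 1 + 2 * C2.
have NC h : N h <= C * `|h|.
  have a1 := prod_norm_fst h; have a2 := prod_norm_snd h.
  have b1 := prod_norm_fst h.1; have b2 := prod_norm_snd h.1.
  have b3 := prod_norm_fst h.2; have b4 := prod_norm_snd h.2.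
  have c1 : ep * `|h.1.1| <= `|h|.
    by apply: le_trans (le_trans b1 a1); rewrite ler_piMl.
  have c2 : C2 * `|h.1.1 - h.2.1| <= C2 * (2 * `|h|).
    rewrite ler_pM2l //; have := ler_normB h.1.1 h.2.1; lra.
  have c3 : Ca * `|h.1.1| <= Ca * `|h| by rewrite ler_pM2l //; lra.
  have := linear_form_abs (lan n) (anC n) h.1.1; have := ler_norm h.1.2.
  have := ler_norm h.2.2; rewrite /N /C ler_norml; lra.
have C0 : 0 < C by rewrite /C; have := C2_gt0; have := Ca_gt0; lra.
have [d d0 hd] := an_normal n ep0.
pose rho := Num.min d (r / 2).
have rho0 : 0 < rho by rewrite lt_min d0 divr_gt0.
have cE : seq_closed [set z : T * T | E1 z.1 /\ E2 n z.2].
  move=> u l Au ul; split.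
    apply: (epi_ball_closed zs_lip _ (conv_fst ul)) => k; exact: (Au k).1.
  apply: (epi_ball_closed (xi_lip n) _ (conv_snd ul)) => k; exact: (Au k).2.
have [||x [xs [Ax xd nx hx]]] := fuzzy_rule
  (seq_complete_prod (seq_complete_prod cW (@realtype_seq_complete R))
                     (seq_complete_prod cW (@realtype_seq_complete R)))
  (asplund_prod (asplund_prod aW (@asplund_real R)) (asplund_prod aW (@asplund_real R)))
  cE sN NC C0 rho0 (mu_gt0 n) (xb := ((w n, zs (g (w n))), (w n, xi n (g (w n))))).
- by split; split => //=; exact: w_ball.
- move=> z [[z1 z2] [z3 z4]]; rewrite le_min => /andP[zd _]; rewrite /N /=.
  have zw : `|z.1.1 - w n| <= d.
    apply: le_trans zd; apply: le_trans (prod_norm_fst _).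
    exact: (prod_norm_fst (z.1 - (w n, zs (g (w n))))).
  have h1 := hd _ z1 zw; have h2 := xi_lip n z1 z3.
  have -> : z.1.1 - w n - (z.2.1 - w n) = z.1.1 - z.2.1.
    by rewrite opprB addrA subrK.
  move: h1; rewrite (linear_formB _ _ (lzn n)); move: h2 z2 z4; rewrite /xi; lra.
- by exists x, xs; split.
Qed.

(* Strict Lipschitz continuity makes the normals to the epigraph of
   [(zn n - zs) \o g] converge weakly* to [0]. *)
Lemma scalarized_limiting_subdiff : limiting_subdiff nW (zs \o g) wb a.
Proof.
have /choice[z /choice[xs hxs]] n := decoupled_normals n.
have lx n : linear_form (xs n) by have [_ _ [_ [/is_dual_linear]]] := hxs n.
pose e1 n : R := n.+1%:R^-1.
have e1_gt0 n : 0 < e1 n by exact: inv_succ_gt0.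
have e1_small e : 0 < e -> exists N, forall n, (N <= n)%N -> e1 n <= e.
  move=> /exists_inv_lt[N hN]; exists N => n Nn.
  exact: le_trans (inv_succ_le R Nn) (ltW hN).
have mu1 n : mu n <= 1.
  apply: le_trans (mu_le n) _.
  by have := inv_succ_le R (leq0n n); rewrite invr1.
have xsN n (h : T * T) : - xs n h <= h.1.2 + h.2.2 - an n h.1.1 + e1 n * `|h.1.1|
    + C2 * `|h.1.1 - h.2.1| + mu n * `|h| by have [_ _ _] := hxs n.
(* [al] and [c] are the horizontal parts of the normals to the epigraphs of [zs \o g] and
   [xi n \o g]; the goal is [c n] tending to zero. *)
pose c n h := xs n ((0, 0), (h, 0)); pose al n h := xs n ((h, 0), (0, 0)).
pose lam n := - xs n ((0, 1), (0, 0)); pose lam2 n := - xs n ((0, 0), (0, 1)).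
have splitE n (x : T * T) : xs n x = al n x.1.1 - lam n * x.1.2 + c n x.2.1 - lam2 n * x.2.2.
  rewrite /al /lam /c /lam2 !mulNr !opprK ![xs n _ * _]mulrC.
  rewrite -!(linear_formZ _ _ (lx n)) -!(linear_formD _ _ (lx n)).
  congr (xs n _); apply: injective_projections; apply: injective_projections;
    by rewrite /= ?scaler0 ?addr0 ?add0r // /GRing.scale /= ?mulr1 ?mulr0 ?addr0 ?add0r.
have lc n : linear_form (c n).
  move=> t u v; rewrite /c -lx; congr (xs n _).
  by apply: injective_projections; apply: injective_projections;
    rewrite /= ?scaler0 ?addr0.
have lal n : linear_form (al n).
  move=> t u v; rewrite /al -lx; congr (xs n _).
  by apply: injective_projections; apply: injective_projections;
    rewrite /= ?scaler0 ?addr0.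
have n01 : `|(0, 1) : T| = 1 by rewrite prod_normE /= normr0 normr1 max_r.
(* Vertical test directions force [lam n] to tend to [1], so the limit has the form [(a, -1)]
   without rescaling. *)
have lam_near n : `|lam n - 1| <= mu n.
  have h1 := xsN n ((0, 1), (0, 0)); have h2 := xsN n ((0, -1), (0, 0)).
  move: h1 h2; rewrite !splitE /= !(linear_form0 (lal _)) !(linear_form0 (lc _)).
  rewrite !(linear_form0 (lan _)) !subrr !normr0.
  have -> : `|((0, 1), (0, 0)) : T * T| = 1.
    by rewrite prod_normE n01 /= prod_normE /= !normr0 maxxx max_l.
  have -> : `|((0, -1), (0, 0)) : T * T| = 1.
    by rewrite !prod_normE /= !normr0 normrN normr1 maxxx max_l ?le_max ?ler01 ?orbT // max_r.
  by rewrite ler_norml; lra.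
have lam2_near n : `|lam2 n| <= 2.
  have h1 := xsN n ((0, 0), (0, 1)); have h2 := xsN n ((0, 0), (0, -1)).
  move: h1 h2; rewrite !splitE /= !(linear_form0 (lal _)) !(linear_form0 (lc _)).
  rewrite !(linear_form0 (lan _)) !subrr !normr0.
  have -> : `|((0, 0), (0, 1)) : T * T| = 1.
    by rewrite prod_normE n01 /= prod_normE /= !normr0 maxxx max_r.
  have -> : `|((0, 0), (0, -1)) : T * T| = 1.
    by rewrite !prod_normE /= !normr0 normrN normr1 maxxx max_r ?le_max ?ler01 ?orbT // max_r.
  by have := mu1 n; have := mu_gt0 n; rewrite ler_norml; lra.
(* Moving both variables together cancels the penalty, so [al n + c n] is close to [an n]. *)
have al_near n h : `|al n h + c n h - an n h| <= 2 * e1 n * `|h|.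
  have key k : - (al n k + c n k - an n k) <= 2 * e1 n * `|k|.
    have := xsN n ((k, 0), (k, 0)); rewrite splitE /= subrr normr0.
    have -> : `|((k, 0), (k, 0)) : T * T| = `|k|.
      by rewrite !prod_normE /= !normr0 maxxx max_l.
    have : mu n * `|k| <= e1 n * `|k| by rewrite ler_wpM2r // mu_le.
    lra.
  have := key h; have := key (- h); rewrite (linear_formN _ (lal n)) (linear_formN _ (lc n)).
  by rewrite (linear_formN _ (lan n)) normrN ler_norml; lra.
pose w1 n := (z n).1.1; pose w2 n := (z n).2.1.
have zd n : `|z n - ((w n, zs (g (w n))), (w n, xi n (g (w n))))| <= mu n by have [] := hxs n.
have zd1 n : `|(z n).1 - (w n, zs (g (w n)))| <= mu n.
  exact: le_trans (prod_norm_fst (z n - _)) (zd n).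
have w1d n : `|w1 n - w n| <= mu n.
  exact: le_trans (prod_norm_fst ((z n).1 - _)) (zd1 n).
have w2d n : `|w2 n - w n| <= mu n.
  apply: le_trans (zd n); apply: le_trans (prod_norm_snd (z n - _)).
  exact: (prod_norm_fst ((z n).2 - ((w n, xi n (g (w n))) : T))).
have w1b n : `|w1 n - wb| <= 3 / 4 * r.
  have := ler_normD (w1 n - w n) (w n - wb); rewrite addrA subrK.
  by have := w_near n; have := w1d n; have := mu_r n; lra.
have w2b n : `|w2 n - wb| <= 3 / 4 * r.
  have := ler_normD (w2 n - w n) (w n - wb); rewrite addrA subrK.
  by have := w_near n; have := w2d n; have := mu_r n; lra.
have w2_cvg : conv w2 wb.
  move=> e e0; have e20 : 0 < e / 2 by rewrite divr_gt0.
  have [N1 h1] := w_cvg e20; have [N2 h2] := e1_small _ e20.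
  exists (maxn N1 N2) => n; rewrite geq_max => /andP[n1 n2].
  have := ler_normD (w2 n - w n) (w n - wb); rewrite addrA subrK.
  have := h1 _ n1; have := h2 _ n2; have := w2d n; have := mu_le n; rewrite -/(e1 n); lra.
have quotient v n : exists t, [/\ 0 < t, t <= e1 n &
    c n v <= lam2 n * xi n (t^-1 *: (g (w2 n + t *: v) - g (w2 n))) + e1 n * ((1 + C2) * `|v|)].
  have [_ _ nx _] := hxs n; have [_ [_ /(_ _ (e1_gt0 n))[d [d0 hd]]]] := frechet_normal_snd nx.
  have K0 : 0 < (1 + C2) * `|v| + 1 by rewrite ltr_wpDl // mulr_ge0 // addr_ge0 // ltW.
  have v0 : 0 < `|v| + 1 by rewrite ltr_wpDl.
  (* The three bounds make [t] tend to zero, keep the test point within the radius of the normality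
     estimate, and keep it in the ball where [g] is Lipschitz. *)
  pose t := Num.min (e1 n) (Num.min (d / 2 / ((1 + C2) * `|v| + 1)) (r / 4 / (`|v| + 1))).
  have [t1 t2 t3] : [/\ t <= e1 n, t <= d / 2 / ((1 + C2) * `|v| + 1) & t <= r / 4 / (`|v| + 1)].
    by rewrite !ge_min !lexx !orbT.
  have t0 : 0 < t by rewrite !lt_min e1_gt0 !divr_gt0.
  exists t; split=> //.
  have tv : t * `|v| <= r / 4.
    move: t3; rewrite ler_pdivlMr //; lra.
  have wt : `|w2 n + t *: v - wb| <= r.
    rewrite addrAC; apply: le_trans (ler_normD _ _) _.
    by rewrite normrZ gtr0_norm //; have := w2b n; lra.
  have w2r : `|w2 n - wb| <= r by have := w2b n; have := r_gt0; lra.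
  pose dpsi := xi n (g (w2 n + t *: v)) - xi n (g (w2 n)).
  have dabs : `|dpsi| <= C2 * (t * `|v|).
    have := xi_lip n wt w2r; have := xi_lip n w2r wt.
    have -> : w2 n - (w2 n + t *: v) = - (t *: v) by rewrite opprD addrA subrr add0r.
    have -> : w2 n + t *: v - w2 n = t *: v by rewrite addrAC subrr add0r.
    by rewrite normrN normrZ (gtr0_norm t0) /dpsi ler_norml; lra.
  pose u : T := (w2 n + t *: v, (z n).2.2 + dpsi).
  have [[_ [_ E2z]] _ _ _] := hxs n.
  have E2u : E2 n u by split=> //=; move: E2z; rewrite /dpsi /w2; lra.
  have uE : u - (z n).2 = (t *: v, dpsi).
    by apply: injective_projections; rewrite /= addrAC subrr add0r.
  have un : `|u - (z n).2| <= (1 + C2) * (t * `|v|).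
    have tv0 : 0 <= t * `|v| by rewrite mulr_ge0 // ltW.
    rewrite uE prod_norm_le /= normrZ gtr0_norm //; apply/andP; split.
      by have := mulr_ge0 (ltW C2_gt0) tv0; lra.
    by apply: le_trans dabs _; lra.
  have ud : nrm (u - (z n).2) < d.
    apply: le_lt_trans un _; move: t2; rewrite ler_pdivlMr //; lra.
  have := hd _ E2u ud; rewrite uE /nrm -uE => hu.
  have : c n (t *: v) - lam2 n * dpsi <= e1 n * ((1 + C2) * (t * `|v|)).
    have : e1 n * `|u - (z n).2| <= e1 n * ((1 + C2) * (t * `|v|)) by rewrite ler_pM2l.
    move: hu; rewrite uE splitE /= (linear_form0 (lal n)); lra.
  rewrite (linear_formZ _ _ (lc n)) (linear_formZ _ _ (lxi n)) (linear_formB _ _ (lxi n)) -/dpsi.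
  move=> h; rewrite -(ler_pM2l t0) mulrDr [t * (lam2 n * _)]mulrCA mulVKf ?gt_eqF //; lra.
have c_upper0 v : (forall (w0 : nat -> W) (t : nat -> R),
      w0 @ \oo --> wb -> (forall k, 0 < t k) -> t @ \oo --> (0 : R) ->
      exists (phi : nat -> nat) (l : Z), (forall k, (phi k < phi k.+1)%N) /\
        (fun k => (t (phi k))^-1 *: (g (w0 (phi k) + t (phi k) *: v) - g (w0 (phi k))))
          @ \oo --> l) -> forall e, 0 < e -> exists N, forall n, (N <= n)%N -> c n v <= e.
  (* Otherwise [c n v > e] along a subsequence, and on a further one the quotients of [g] converge
     in norm to some [l]. There [xi n] is small: it tends to zero at [l] and is equibounded on the
     difference. The errors add up to [2 * (3 * e / 16) + e / 2 < e]. *)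
  move=> hv e e0; apply: contrapT => no.
  have /(@subsequence_choice (fun _ n => e < c n v))[psi [psi_incr hpsi]] :
      forall k N : nat, exists2 n, (N <= n)%N & e < c n v.
    move=> _ N; apply: contrapT => no'; apply: no; exists N => n Nn.
    by rewrite leNgt; apply/negP => h; apply: no'; exists n.
  have psi_ge := subsequence_ge psi_incr.
  have /choice[t ht] := quotient v.
  have [|k||phi [l [phi_incr /convP hl]]] := hv (fun k => w2 (psi k)) (fun k => t (psi k)).
  - apply/convP => ee /w2_cvg[N hN]; exists N => k Nk.
    exact: hN (leq_trans Nk (psi_ge k)).
  - by have [] := ht (psi k).
  - apply/(@convP R R^o) => ee /e1_small[N hN]; exists N => k Nk; rewrite subr0.
    have [t0 te _] := ht (psi k); rewrite gtr0_norm //; apply: le_trans te _.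
    exact: hN (leq_trans Nk (psi_ge k)).
  have phi_ge := subsequence_ge phi_incr; have m_ge k := leq_trans (phi_ge k) (psi_ge (phi k)).
  pose K := (1 + C2) * `|v| + 1.
  have K0 : 0 < K by rewrite ltr_wpDl // mulr_ge0 // addr_ge0 // ltW.
  have [N1 h1] := e1_small _ (divr_gt0 (divr_gt0 e0 (ltr0n R 2)) K0).
  have Cz8 : 0 < 16 * Cz by rewrite mulr_gt0.
  have [N2 h2] := hl _ (divr_gt0 e0 Cz8).
  have [N3 h3] := zn_cvg l (divr_gt0 e0 (ltr0n R 16)).
  pose k := maxn N1 (maxn N2 N3).
  have k1 : (N1 <= k)%N by rewrite leq_maxl.
  have k2 : (N2 <= k)%N by rewrite !leq_max leqnn orbT.
  have k3 : (N3 <= k)%N by rewrite !leq_max leqnn !orbT.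
  have [_ _] := ht (psi (phi k)).
  have := h2 _ k2; rewrite /=; set Q := (_ *: _) => hQ hc.
  have hx : `|xi (psi (phi k)) Q| <= 3 * (e / 16).
    have -> : Q = (Q - l) + l by rewrite subrK.
    rewrite (linear_formD _ _ (lxi _)); apply: le_trans (ler_normD _ _) _.
    have := h3 _ (leq_trans k3 (m_ge k)); rewrite -/(xi (psi (phi k)) l).
    have := xi_abs (psi (phi k)) (Q - l).
    have : 2 * Cz * `|Q - l| <= 2 * (e / 16).
      by move: hQ; rewrite ler_pdivlMr //; lra.
    lra.
  have hlx : lam2 (psi (phi k)) * xi (psi (phi k)) Q <= 2 * (3 * (e / 16)).
    apply: le_trans (ler_norm _) _; rewrite normrM; exact: ler_pM.
  have he : e1 (psi (phi k)) * ((1 + C2) * `|v|) <= e / 2.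
    have := h1 _ (leq_trans k1 (m_ge k)); rewrite ler_pdivlMr // /K.
    by have := e1_gt0 (psi (phi k)); lra.
  by have := hpsi (phi k); lra.
(* Every [v] is scaled into the neighborhood [V0] of strict Lipschitz continuity. *)
have c_upper v e : 0 < e -> exists N, forall n, (N <= n)%N -> c n v <= e.
  move=> e0; have [_ [V0 [/nbhs_ballP[d /= d0 hd] hV]]] := g_strict.
  have v0 : 0 < `|v| + 1 by rewrite ltr_wpDl.
  pose s := d / 2 / (`|v| + 1); have s0 : 0 < s by rewrite !divr_gt0.
  have Vs : V0 (s *: v).
    apply: hd; rewrite -ball_normE /= sub0r normrN normrZ gtr0_norm // /s.
    by rewrite mulrAC ltr_pdivrMr //; have := normr_ge0 v; nra.
  have [N hN] := c_upper0 _ (hV _ Vs) _ (mulr_gt0 s0 e0).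
  by exists N => n /hN; rewrite (linear_formZ _ _ (lc n)) ler_pM2l.
have c_cvg v e : 0 < e -> exists N, forall n, (N <= n)%N -> `|c n v| <= e.
  move=> e0; have [N1 h1] := c_upper v _ e0; have [N2 h2] := c_upper (- v) _ e0.
  exists (maxn N1 N2) => n; rewrite geq_max => /andP[n1 n2].
  have := h1 _ n1; have := h2 _ n2; rewrite (linear_formN _ (lc n)) ler_norml; lra.
have al_cvg h e : 0 < e -> exists N, forall n, (N <= n)%N -> `|al n h - a h| <= e.
  move=> e0; have e30 : 0 < e / 3 by rewrite divr_gt0.
  have [N1 h1] := c_cvg h _ e30; have [N2 h2] := an_cvg h e30.
  have h0 : 0 < 2 * (`|h| + 1) by rewrite mulr_gt0 // ltr_wpDl.
  have [N3 h3] := e1_small _ (divr_gt0 e30 h0).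
  exists (maxn N1 (maxn N2 N3)) => n; rewrite !geq_max => /and3P[n1 n2 n3].
  have := h1 _ n1; have := h2 _ n2; have := h3 _ n3; rewrite ler_pdivlMr //.
  by have := al_near n h; have := e1_gt0 n; rewrite !ler_norml; lra.
have epiE n : epi (zs \o g) (z n).1 by have [[[_ ?] _] _ _ _] := hxs n.
split; first exact: lexx.
split.
  apply: (@linear_form_is_dual R T _ (Ca + 1)) => [t u v|u].
    by rewrite /= la /GRing.scale /=; ring.
  have := linear_form_abs la aC u.1; have := prod_norm_snd u.
  have : Ca * `|u.1| <= Ca * `|u| by rewrite ler_pM2l // prod_norm_fst.
  by rewrite !ler_norml; lra.
exists (fun n => (z n).1), (fun n h => xs n (h, 0)); split; [exact: epiE|split; [|split]].
- apply/(@convP R T) => e e0; have e20 : 0 < e / 2 by rewrite divr_gt0.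
  have K0 : 0 < 1 + Cz * Lg by rewrite addr_gt0 // mulr_gt0.
  have [N1 h1] := e1_small _ e20; have [N2 h2] := w_cvg (divr_gt0 e20 K0).
  exists (maxn N1 N2) => n; rewrite geq_max => /andP[n1 n2].
  have := h1 _ n1; have := h2 _ n2; rewrite ler_pdivlMr // => k2 k1.
  have wb0 : `|wb - wb| <= r by rewrite subrr normr0 ltW.
  have kz : `|((w n, zs (g (w n))) : T) - (wb, zs (g wb))| <= (1 + Cz * Lg) * `|w n - wb|.
    have L0 : 0 <= Cz * Lg * `|w n - wb| by rewrite !mulr_ge0 // ltW.
    rewrite prod_norm_le /=; apply/andP; split; first by lra.
    have := zs_lip (w_ball n) wb0; have := zs_lip wb0 (w_ball n).
    by rewrite [ `|wb - w n| ]distrC; have := normr_ge0 (w n - wb); rewrite ler_norml; lra.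
  have := ler_normD ((z n).1 - (w n, zs (g (w n)))) ((w n, zs (g (w n))) - (wb, zs (g wb))).
  rewrite addrA subrK; have := zd1 n; have := mu_le n; rewrite -/(e1 n) /comp; lra.
- move=> n; apply: (@frechet_normal_norm R T).
    move=> v; rewrite /sum_norm /nrm; apply: le_trans (prod_norm_le_add _) _.
    by rewrite lerD2r; exact: nW_ge.
  have [_ _ nx _] := hxs n.
  have r4 : 0 < r / 4 by rewrite divr_gt0.
  apply: (@frechet_normal_local R T E1 _ _ _ _ r4 (epiE n) _ (frechet_normal_fst nx)).
  move=> u eu ur; split=> //; have := prod_norm_fst (u - (z n).1).
  have := ler_normD (u.1 - w1 n) (w1 n - wb); rewrite addrA subrK.
  by have := w1b n; rewrite /w1 /=; lra.
- move=> v; apply/(@convP R R^o) => e e0.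
  have e20 : 0 < e / 2 by rewrite divr_gt0.
  have [N1 h1] := al_cvg v.1 _ e20.
  have v0 : 0 < `|v.2| + 1 by rewrite ltr_wpDl.
  have [N2 h2] := e1_small _ (divr_gt0 e20 v0).
  exists (maxn N1 N2) => n; rewrite geq_max => /andP[n1 n2].
  rewrite splitE /= (linear_form0 (lc n)).
  have := h1 _ n1; have := h2 _ n2; rewrite ler_pdivlMr // => k2 k1.
  have : `|(lam n - 1) * v.2| <= e / 2.
    rewrite normrM; apply: (@le_trans _ _ (e1 n * `|v.2|)).
      by apply: ler_wpM2r => //; exact: le_trans (lam_near n) (mu_le n).
    by have := e1_gt0 n; lra.
  by move: k1; rewrite !ler_norml; lra.
Qed.

End Scalarization.

(** * Scalarization and exact penalization *)

Lemma nbhs_norm_ball (R : realType) (V : normedModType R) (x : V) (A : set V) :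
  nbhs x A <-> exists2 d : R, 0 < d & forall y, `|y - x| < d -> A y.
Proof.
split=> [/nbhs_ballP[d /= d0 hd]|[d d0 hd]].
  by exists d => // y; rewrite distrC => yd; apply: hd; rewrite -ball_normE.
apply/nbhs_ballP; exists d => // y; rewrite -ball_normE /= => yd.
by apply: hd; rewrite distrC.
Qed.

(* The Gerstewitz functional [s z = inf {t | t e - z \in K}]. *)
Lemma gerstewitz (R : realType) (Z : normedModType R) (K : set Z) (e : Z) :
  convex_cone K -> interior K e -> ~ interior K 0 ->
  exists (s : Z -> R) (C : R),
  [/\ sublinear s, 0 < C /\ (forall z, s z <= C * `|z|),
      forall z, s z < 0 -> interior K (- z), forall z, K z -> s (- z) <= 0 &
      s e <= 1 /\ s (- e) <= - 1].
Proof.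
move=> [K0 [KZ KD]] /nbhs_norm_ball[rho rho0 hrho] nK0.
(* A ball of radius [rho] about [e] lies in [K]; the factor [2] puts the scaled point strictly
   inside it. *)
pose C := 2 / rho; have C0 : 0 < C by rewrite divr_gt0.
have Ke : K e by apply: hrho; rewrite subrr normr0.
have KC z : K ((C * `|z|) *: e - z).
  have [->|z0] := eqVneq z 0; first by rewrite normr0 mulr0 scale0r subr0.
  have c0 : 0 < C * `|z| by rewrite mulr_gt0 // normr_gt0.
  have -> : (C * `|z|) *: e - z = (C * `|z|) *: (e - (C * `|z|)^-1 *: z).
    by rewrite scalerBr scalerA divff ?gt_eqF // scale1r.
  apply: KZ; first exact: ltW.
  apply: hrho; rewrite addrAC subrr add0r normrN normrZ gtr0_norm ?invr_gt0 //.
  rewrite invfM -mulrA mulVf ?normr_eq0 // mulr1 /C invf_div.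
  by rewrite ltr_pdivrMr //; lra.
(* With [- e] in [K], the ball about [e] would translate to a ball about [0] in [K]. Excluding this
   bounds [s] from below. *)
have nKe : ~ K (- e).
  move=> KNe; apply: nK0; apply/nbhs_norm_ball; exists rho => // y.
  rewrite subr0 => yr; have -> : y = (y + e) + (- e) by rewrite addrK.
  by apply: KD => //; apply: hrho; rewrite addrK.
have lb z t : K (t *: e - z) -> - (C * `|z|) <= t.
  move=> Kt; rewrite leNgt; apply/negP => h; apply: nKe.
  have := KD _ _ Kt (KC (- z)); rewrite opprK normrN addrACA addNr addr0 -scalerDl.
  set a := t + _ => Ka; have a0 : 0 < - a^-1 by rewrite oppr_gt0 invr_lt0 /a; lra.
  have := KZ _ _ (ltW a0) Ka; rewrite scalerA mulNr mulVf ?scaleN1r //.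
  by rewrite lt_eqF // /a; lra.
pose S z := [set t | K (t *: e - z)].
pose s z := inf [set t | t in S z].
have sle z t : K (t *: e - z) -> s z <= t.
  by move=> Kt; apply: (@inf_image_le _ _ _ id (- (C * `|z|))) => // y; exact: lb.
have les z b : (forall t, K (t *: e - z) -> b <= t) -> b <= s z.
  by move=> h; apply: le_inf_image => //; exists (C * `|z|); exact: KC.
have sC z : s z <= C * `|z| by exact/sle/KC.
have s_homo t u : 0 < t -> s (t *: u) <= t * s u.
  move=> t0; rewrite mulrC -ler_pdivrMr //; apply: (les _ _) => b Kb.
  rewrite ler_pdivrMr //; apply: (sle _ _).
  by have := KZ _ _ (ltW t0) Kb; rewrite scalerBr scalerA mulrC.
have s0 : s 0 = 0.
  apply/eqP; rewrite eq_le; apply/andP; split.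
    by have := sC 0; rewrite normr0 mulr0.
  by apply: (les _ _) => t /lb; rewrite normr0 mulr0 oppr0.
exists s, C; split=> //.
- split=> [u v|t u].
    rewrite -lerBlDr; apply: (les _ _) => t Kt.
    rewrite lerBlDr -lerBlDl; apply: (les _ _) => t' Kt'.
    rewrite lerBlDl; apply: (sle _ _).
    by have := KD _ _ Kt Kt'; rewrite addrACA -scalerDl -opprD.
  rewrite le_eqVlt => /orP[/eqP <-|t0]; first by rewrite scale0r mul0r s0.
  apply/eqP; rewrite eq_le s_homo //=.
  have ti0 : 0 < t^-1 by rewrite invr_gt0.
  have := s_homo _ (t *: u) ti0; rewrite scalerA mulVf ?gt_eqF // scale1r.
  by rewrite -(ler_pM2l t0) mulrA divff ?gt_eqF // mul1r.
- move=> z sz; have hi : has_inf [set t | t in S z].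
    split; first by exists (C * `|z|), (C * `|z|) => //; exact: KC.
    by exists (- (C * `|z|)) => _ [t Kt <-]; exact: lb.
  have sz' : 0 < - s z by lra.
  have [_ [t Kt <-] ht] := inf_adherent sz' hi.
  have t0 : 0 < - t by move: ht; rewrite -/(s z); lra.
  apply/nbhs_norm_ball; exists (- t * rho) => [|y]; first by rewrite mulr_gt0.
  rewrite opprK => yz.
  (* A negative [t] leaves [- t] copies of [e] to spare, and the ball about [e] absorbs the
     perturbation [y + z]. *)
  have -> : y = (t *: e - z) + (- t) *: (e + (- t)^-1 *: (y + z)).
    rewrite scalerDr scalerA divff ?gt_eqF // scale1r scaleNr addrACA subrr add0r.
    by rewrite addrC addrK.
  apply: KD => //; apply: KZ; first exact: ltW.
  apply: hrho; rewrite addrAC subrr add0r normrZ gtr0_norm ?invr_gt0 //.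
  by rewrite mulrC ltr_pdivrMr // mulrC.
- by move=> z Kz; apply: (sle _ _); rewrite scale0r opprK add0r.
- split; first by apply: (sle _ _); rewrite scale1r subrr.
  by apply: (sle _ _); rewrite scaleN1r opprK addNr.
Qed.

Lemma sum_norm_ge (R : realType) (V W : normedModType R) (n1 : V -> R) (n2 : W -> R) :
  (forall v, `|v| <= n1 v) -> (forall v, `|v| <= n2 v) ->
  forall z : V * W, `|z| <= sum_norm n1 n2 z.
Proof.
move=> h1 h2 z; apply: le_trans (prod_norm_le_add z) _.
by rewrite /sum_norm lerD.
Qed.

Section ExactPenalty.
Variables (R : realType) (X Y Z P : normedModType R) (K : set Z).
Variables (g : X * P -> Z) (H : X * P -> set Y) (wb : X * P).
Variables (s : Z -> R) (Cs L rr r0 : R).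
Hypotheses (ss : sublinear s) (Cs_gt0 : 0 < Cs) (sC : forall z, s z <= Cs * `|z|).
Hypothesis s_neg : forall z, s z < 0 -> interior K (- z).
Hypotheses (L_gt0 : 0 < L) (rr_gt0 : 0 < rr) (r0_gt0 : 0 < r0).
Hypothesis g_lip : forall a b, `|a - wb| < r0 -> `|b - wb| < r0 ->
  `|g a - g b| <= L * (`|a.1 - b.1| + `|a.2 - b.2|).
Hypothesis wb_sol : forall w, `|w - wb| < r0 -> H w 0 ->
  ~ interior K (- (g w - g wb)).
Hypothesis H_dist : forall x p, `|(x, p) - wb| < r0 ->
  (dist (sum_norm (@nrm R P) (@nrm R X)) (p, x)
        [set q : P * X | H (q.2, q.1) (0%R : Y)]
   <= rr%:E * dist (sum_norm (sum_norm (@nrm R X) (@nrm R P)) (@nrm R Y))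
                  ((x, p), (0%R : Y)) (graph H))%E.

(** If the value were negative, the metric estimate would give a feasible point closer to [w] than
    [sg / (Cs * L)]. The Lipschitz bound keeps [s (g - g wb)] negative there, contradicting weak
    optimality. *)
Lemma exact_penalty w u v : `|w - wb| <= r0 / 4 -> H u v ->
  0 <= s (g w - g wb) + 2 * Cs * L * rr * (`|w - u| + `|v|).
Proof.
move=> wr Huv; rewrite leNgt; apply/negP => neg.
have wr0 : `|w - wb| < r0 by apply: le_lt_trans wr _; have := r0_gt0; lra.
pose sg := - s (g w - g wb).
pose t := `|w.1 - u.1| + `|w.2 - u.2| + `|v|.
pose l := Cs * L; have l_gt0 : 0 < l by rewrite mulr_gt0.
have h1 : `|w.1 - u.1| <= `|w - u| := prod_norm_fst (w - u).
have h2 : `|w.2 - u.2| <= `|w - u| := prod_norm_snd (w - u).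
(* The factor [2] of the penalty is spent here, where the sum norm [t] is bounded by max norms. *)
have tsg : rr * t < sg / l.
  rewrite ltr_pdivlMr //; have : rr * l * t <= rr * l * (2 * (`|w - u| + `|v|)).
    by rewrite ler_pM2l ?mulr_gt0 // /t; have := normr_ge0 v; lra.
  by move: neg; rewrite /sg /l; lra.
have : (dist (sum_norm (@nrm R P) (@nrm R X)) (w.2, w.1)
        [set q : P * X | H (q.2, q.1) (0%R : Y)] < (sg / l)%:E)%E.
  have hw : `|(w.1, w.2) - wb| < r0 by rewrite -surjective_pairing.
  apply: le_lt_trans (H_dist hw) _; apply: (@le_lt_trans _ _ (rr * t)%:E); last first.
    by rewrite lte_fin.
  rewrite EFinM lee_pmul2l ?lte_fin // ?fin_numE //; apply: ereal_inf_lbound.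
  exists (u, v); first exact: Huv.
  by rewrite /sum_norm /nrm /= /t sub0r normrN.
move=> /ereal_inf_lt[_ [q Hq <-]]; rewrite lte_fin /sum_norm /nrm /= => hq.
pose q' : X * P := (q.2, q.1).
pose d := `|w.2 - q.1| + `|w.1 - q.2|.
(* Ensures that the feasible point stays within [3 * |w - wb| < r0] of [wb], where the hypotheses
   are available. *)
have sgw : sg <= l * (2 * `|w - wb|).
  have := sublinear_opp_ge (- (g w - g wb)) ss; rewrite opprK -/sg opprB => h.
  apply: le_trans h _; apply: le_trans (sC _) _; rewrite /l -mulrA ler_pM2l //.
  have wb0 : `|wb - wb| < r0 by rewrite subrr normr0.
  apply: le_trans (g_lip wb0 wr0) _; rewrite ler_pM2l // [ `|wb.1 - _| ]distrC [ `|wb.2 - _| ]distrC.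
  have : `|w.1 - wb.1| <= `|w - wb| := prod_norm_fst (w - wb).
  have : `|w.2 - wb.2| <= `|w - wb| := prod_norm_snd (w - wb).
  lra.
have dw : d < 2 * `|w - wb|.
  by apply: lt_le_trans hq _; rewrite ler_pdivrMr // mulrC.
have q'w : `|q' - w| <= d.
  apply: le_trans (prod_norm_le_add _) _; rewrite /= /d addrC.
  by rewrite [ `|q.1 - _| ]distrC [ `|q.2 - _| ]distrC.
have q'r0 : `|q' - wb| < r0.
  have := ler_normD (q' - w) (w - wb); rewrite addrA subrK; have := r0_gt0; lra.
apply: (wb_sol q'r0 Hq); apply: s_neg.
have -> : g (q.2, q.1) - g wb = (g w - g wb) + (g q' - g w).
  by rewrite [RHS]addrC addrA subrK.
apply: le_lt_trans (ss.1 _ _) _.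
have : s (g q' - g w) <= l * d.
  apply: le_trans (sC _) _; rewrite /l -mulrA ler_pM2l //.
  apply: le_trans (g_lip q'r0 wr0) _; rewrite ler_pM2l // /d addrC.
  by rewrite [ `|q'.1 - _| ]distrC [ `|q'.2 - _| ]distrC.
by move: hq; rewrite -/d ltr_pdivlMr // /sg; lra.
Qed.

End ExactPenalty.

Lemma graph_ball_closed (R : realType) (W Z : normedModType R) (g : W -> Z) wb zb (r K : R) :
  0 < K ->
  (forall a b, `|a - wb| <= r -> `|b - wb| <= r -> `|g a - g b| <= K * `|a - b|) ->
  seq_closed [set z : W * Z | `|z.1 - wb| <= r /\ z.2 = g z.1 - zb].
Proof.
move=> K0 lip u l Au ul; have u1 := conv_fst ul; have u2 := conv_snd ul.
have lr : `|l.1 - wb| <= r.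
  apply/ler_addgt0Pr => e e0; have [M hM] := u1 _ e0.
  have [h _] := Au M; have := hM _ (leqnn _).
  have := ler_normD (l.1 - (u M).1) ((u M).1 - wb); rewrite addrA subrK.
  by rewrite [ `|l.1 - _| ]distrC; lra.
split=> //; apply/eqP; rewrite -subr_eq0 -normr_le0; apply/ler_addgt0Pr => e e0.
have K1 : 0 < K + 1 by rewrite addr_gt0.
pose e' := e / (K + 1); have e'0 : 0 < e' by rewrite divr_gt0.
have eE : e = (K + 1) * e' by rewrite mulrC divfK ?gt_eqF.
have [M1 h1] := u1 _ e'0; have [M2 h2] := u2 _ e'0.
pose M := maxn M1 M2; have [h hz] := Au M.
have k1 := h1 _ (leq_maxl M1 M2 : (_ <= M)%N); have k2 := h2 _ (leq_maxr M1 M2 : (_ <= M)%N).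
have k3 : `|g (u M).1 - g l.1| <= K * e'.
  by apply: le_trans (lip _ _ h lr) _; rewrite ler_pM2l.
have -> : l.2 - (g l.1 - zb) = (l.2 - (u M).2) + (g (u M).1 - g l.1).
  by rewrite hz !opprB !addrA subrK addrAC.
rewrite add0r eE; apply: le_trans (ler_normD _ _) _.
by rewrite [ `|l.2 - _| ]distrC; lra.
Qed.

(** * Passage to the limit in the fuzzy multipliers *)

Unset Implicit Arguments.

Theorem theorem4p3 (R : realType) (X Y Z P : completeNormedModType R)
  (K : set Z) (g : X * P -> Z) (H : X * P -> set Y) (xb : X) (pb : P) (L : R) :
  asplund X -> asplund Y -> asplund Z -> asplund P ->
  closed K -> convex_cone K -> pointed K -> interior K !=set0 ->
  closed (graph H) ->
  0 < L ->
  (* (1) g is L-strictly Lipschitz at (xb, pb) *)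
  strictly_lipschitz (sum_norm (@nrm R X) (@nrm R P)) g (xb, pb) ->
  (exists N : set (X * P), nbhs (xb, pb) N /\
     forall a b, N a -> N b ->
       `|g a - g b| <= L * (`|a.1 - b.1| + `|a.2 - b.2|)) ->
  (* (2) local weak solution *)
  H (xb, pb) 0 ->
  (exists (U : set X) (W : set P), nbhs xb U /\ nbhs pb W /\
     forall x p, U x -> W p -> H (x, p) 0 ->
       ~ interior K (- (g (x, p) - g (xb, pb)))) ->
  (* (3) metric-type estimate *)
  (exists r : R, 0 < r /\ exists N : set (X * P), nbhs (xb, pb) N /\
     forall x p, N (x, p) ->
       (dist (sum_norm (@nrm R P) (@nrm R X)) (p, x)
            [set q : P * X | H (q.2, q.1) (0%R : Y)]
       <= r%:E * dist (sum_norm (sum_norm (@nrm R X) (@nrm R P)) (@nrm R Y))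
                      ((x, p), (0%R : Y)) (graph H))%E) ->
  forall e, interior K e ->
  exists zs : Z -> R, dual_cone K zs /\ zs e = 1 /\
  exists ys : Y -> R, is_dual ys /\
  exists a b : X * P -> R,
    limiting_subdiff (sum_norm (@nrm R X) (@nrm R P)) (zs \o g) (xb, pb) a /\
    normal_coderiv (sum_norm (@nrm R X) (@nrm R P)) (@nrm R Y) H (xb, pb) 0 ys b /\
    forall w, a w + b w = 0.
Proof.
move=> aX aY aZ aP clK cK _ _ clH L0 gS [N1 [nN1 g_lip]] H0 [U [W' [nU [nW' sol]]]]
  [rr [rr0 [N3 [nN3 hdist]]]] e Ke.
pose W := (X * P)%type; pose wb : W := (xb, pb).
(* The solution is itself feasible and has zero increment. *)
have nK0 : ~ interior K 0.
  move=> K0; apply: (sol xb pb (nbhs_singleton nU) (nbhs_singleton nW') H0).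
  by rewrite subrr oppr0.
have [s [Cs [ss [Cs0 sC] sneg sK [se sNe]]]] := gerstewitz cK Ke nK0.
have [r0 [r00 hN1 hUW hN3]] : exists r0 : R, [/\ 0 < r0,
    forall a : W, `|a - wb| < r0 -> N1 a,
    forall a : W, `|a - wb| < r0 -> U a.1 /\ W' a.2 &
    forall a : W, `|a - wb| < r0 -> N3 a].
  have [d1 d10 h1] := (nbhs_norm_ball wb N1).1 nN1.
  have [d2 d20 h2] := (nbhs_norm_ball xb U).1 nU.
  have [d3 d30 h3] := (nbhs_norm_ball pb W').1 nW'.
  have [d4 d40 h4] := (nbhs_norm_ball wb N3).1 nN3.
  exists (Num.min (Num.min d1 d2) (Num.min d3 d4)); split.
  - by rewrite !lt_min d10 d20 d30 d40.
  - by move=> a; rewrite !lt_min => /andP[/andP[/h1]].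
  - move=> a; rewrite !lt_min => /andP[/andP[_ a2] /andP[a3 _]]; split.
      by apply: h2; apply: le_lt_trans a2; exact: (prod_norm_fst (a - wb)).
    by apply: h3; apply: le_lt_trans a3; exact: (prod_norm_snd (a - wb)).
  - by move=> a; rewrite !lt_min => /andP[_ /andP[_ /h4]].
pose r := r0 / 4; have r_gt0 : 0 < r by rewrite divr_gt0.
pose C := 2 * Cs * L * rr; have C0 : 0 < C by rewrite !mulr_gt0.
have pen (w u : W) v : `|w - wb| <= r -> H u v -> 0 <= s (g w - g wb) + C * (`|w - u| + `|v|).
  apply: (exact_penalty ss Cs0 sC sneg L0 rr0 r00).
  - by move=> a b /hN1 Na /hN1; exact: g_lip.
  - by move=> [x p] /hUW[Ux Wp]; exact: sol.
  - by move=> x p /hN3; exact: hdist.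
pose Lg := 2 * L; have Lg0 : 0 < Lg by rewrite mulr_gt0.
have glip (a b : W) : `|a - wb| <= r -> `|b - wb| <= r -> `|g a - g b| <= Lg * `|a - b|.
  have rr' : r < r0 by rewrite /r; lra.
  move=> /le_lt_trans /(_ rr') /hN1 Na /le_lt_trans /(_ rr') /hN1 Nb.
  apply: le_trans (g_lip _ _ Na Nb) _; rewrite /Lg [2 * L]mulrC -mulrA ler_pM2l //.
  have : `|a.1 - b.1| <= `|a - b| := prod_norm_fst (a - b).
  have : `|a.2 - b.2| <= `|a - b| := prod_norm_snd (a - b).
  lra.
have cX := @complete_seq_complete R X; have cY := @complete_seq_complete R Y.
have cZ := @complete_seq_complete R Z; have cP := @complete_seq_complete R P.
have cW : seq_complete W := seq_complete_prod cX cP.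
have aW : asplund_space W := asplund_prod (aX : asplund_space X) (aP : asplund_space P).
pose V := ((W * Z) * (W * Y))%type.
have cV : seq_complete V := seq_complete_prod (seq_complete_prod cW cZ) (seq_complete_prod cW cY).
have aV : asplund_space V := asplund_prod (asplund_prod aW (aZ : asplund_space Z))
  (asplund_prod aW (aY : asplund_space Y)).
(* The ball makes this graph closed, [g] being known to be continuous only near [wb]. *)
pose G : set (W * Z) := [set z | `|z.1 - wb| <= r /\ z.2 = g z.1 - g wb].
pose A : set V := [set z | G z.1 /\ graph H z.2].
have clA : seq_closed A.
  move=> u l Au ul; split.
    apply: (graph_ball_closed Lg0 glip _ (conv_fst ul)) => n; exact: (Au n).1.
  apply: (closed_seq_closed clH _ (conv_snd ul)) => n; exact: (Au n).2.
pose N (v : V) : R := s v.1.2 + C * (`|v.1.1 - v.2.1| + `|v.2.2|).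
have sN : sublinear N.
  split=> [u v|t u t0]; rewrite /N /=.
    have -> : u.1.1 + v.1.1 - (u.2.1 + v.2.1) = (u.1.1 - u.2.1) + (v.1.1 - v.2.1).
      by rewrite opprD addrACA.
    have h1 := ss.1 u.1.2 v.1.2.
    have : C * (`|u.1.1 - u.2.1 + (v.1.1 - v.2.1)| + `|u.2.2 + v.2.2|) <=
           C * ((`|u.1.1 - u.2.1| + `|v.1.1 - v.2.1|) + (`|u.2.2| + `|v.2.2|)).
      by rewrite ler_pM2l // lerD // ler_normD.
    lra.
  by rewrite ss.2 // -scalerBr !normrZ ger0_norm //; ring.
pose CN := Cs + 3 * C; have CN0 : 0 < CN by rewrite /CN; lra.
have NC v : N v <= CN * `|v|.
  have a1 := prod_norm_fst v; have a2 := prod_norm_snd v.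
  have b1 := prod_norm_fst v.1; have b2 := prod_norm_snd v.1.
  have b3 := prod_norm_fst v.2; have b4 := prod_norm_snd v.2.
  have c1 : Cs * `|v.1.2| <= Cs * `|v| by rewrite ler_pM2l //; lra.
  have c2 : C * (`|v.1.1 - v.2.1| + `|v.2.2|) <= C * (3 * `|v|).
    by rewrite ler_pM2l //; have := ler_normB v.1.1 v.2.1; lra.
  by have := sC v.1.2; rewrite /N /CN; lra.
pose vb : V := ((wb, 0), (wb, 0)).
have Avb : A vb by split=> //; split; rewrite /= subrr ?normr0 // ltW.
have vb_min v : A v -> `|v - vb| <= 1 -> 0 <= N (v - vb).
  move=> [[v1 v2] Hv] _; rewrite /N /= !subr0 v2.
  by have := pen _ _ _ v1 Hv; rewrite opprB addrA subrK.
(* The cap [r / 2] supplies [w_near] for the second use of the rule. *)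
pose mu n : R := Num.min n.+1%:R^-1 (r / 2).
have mu_gt0 n : 0 < mu n by rewrite lt_min inv_succ_gt0 divr_gt0.
have mu_le n : mu n <= n.+1%:R^-1 by rewrite ge_min lexx.
have mu_r n : mu n <= r / 2 by rewrite ge_min lexx orbT.
have mu1 n : mu n <= 1.
  by apply: le_trans (mu_le n) _; have := inv_succ_le R (leq0n n); rewrite invr1.
have mu_small ep : 0 < ep -> exists M, forall n, (M <= n)%N -> mu n <= ep.
  move=> /exists_inv_lt[M hM]; exists M => n Mn.
  exact: le_trans (mu_le n) (le_trans (inv_succ_le R Mn) (ltW hM)).
have /choice[v /choice[xs hxs]] n :=
  fuzzy_rule cV aV clA sN NC CN0 ltr01 (mu_gt0 n) Avb vb_min.
have lx n : linear_form (xs n) by have [_ _ [_ [/is_dual_linear]]] := hxs n.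
have CV0 : 0 < CN + 1 by rewrite addr_gt0.
have xsC n h : xs n h <= (CN + 1) * `|h|.
  have [_ _ _ /(_ (- h))] := hxs n; rewrite (linear_formN _ (lx n)) opprK normrN.
  have := NC (- h); rewrite normrN; have := normr_ge0 h; have := mu1 n; nra.
have [phi [gg [phi_incr lgg ggC gg_cvg]]] := weak_star_seq_compact cV aV CV0 lx xsC.
have phi_ge := subsequence_ge phi_incr.
have vphi_cvg : conv (fun n => v (phi n)) vb.
  move=> ep /mu_small[M hM]; exists M => n Mn; have [_ vd _ _] := hxs (phi n).
  exact: le_trans vd (hM _ (leq_trans Mn (phi_ge n))).
have xs_lim h c : (forall n, - xs n h <= c + mu n * `|h|) -> - gg h <= c.
  move=> hh; apply/ler_addgt0Pr => ep ep0; have ep20 : 0 < ep / 2 by rewrite divr_gt0.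
  have h0 : 0 < `|h| + 1 by rewrite ltr_wpDl.
  have [M1 h1] := gg_cvg h _ ep20; have [M2 h2] := mu_small _ (divr_gt0 ep20 h0).
  have := h1 _ (leq_maxl M1 M2).
  have := h2 _ (leq_trans (leq_maxr M1 M2) (phi_ge _)); rewrite ler_pdivlMr //.
  have := hh (phi (maxn M1 M2)); have := mu_gt0 (phi (maxn M1 M2)).
  by rewrite ler_norml; lra.
have ggN h : - gg h <= N h.
  by apply: xs_lim => n; have [_ _ _ hh] := hxs n; exact: hh.
(* The signs turn [- gg <= N] into [zs <= s] and make [(b, - ys)] the part of [gg] normal to the
   graph of [H]. *)
pose zs z := - gg ((0, z), (0, 0)); pose ys y := - gg ((0, 0), (0, y)).
pose a h := gg ((h, 0), (0, 0)); pose b h := gg ((0, 0), (h, 0)).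
have pairV : forall f : V -> R, linear_form f -> [/\
    linear_form (fun z : Z => f ((0, z), (0, 0))),
    linear_form (fun h : W => f ((h, 0), (0, 0))),
    linear_form (fun h : W => f ((0, 0), (h, 0))) &
    linear_form (fun y : Y => f ((0, 0), (0, y)))].
  move=> f lf; split=> t u u'; rewrite -lf; congr f;
    by apply: injective_projections; apply: injective_projections;
       rewrite /= ?scaler0 ?addr0.
have [lz la lb ly] := pairV _ lgg.
have pairN (h : W) (z : Z) (h' : W) (y : Y) c : `|h| <= c -> `|z| <= c -> `|h'| <= c ->
    `|y| <= c -> `|((h, z), (h', y)) : V| <= c.
  move=> h1 h2 h3 h4; rewrite prod_norm_le; apply/andP.
  by split; rewrite prod_norm_le; apply/andP.
have lzs : linear_form zs by move=> t u u'; rewrite /zs lz; ring.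
have lys : linear_form ys by move=> t u u'; rewrite /ys ly; ring.
have zs_s z : zs z <= s z.
  have := ggN ((0, z), (0, 0)); rewrite /N /= subrr !normr0; rewrite /zs; lra.
have zs_dual : is_dual zs.
  by apply: (linear_form_is_dual lzs) => z; exact: le_trans (zs_s z) (sC z).
have zse : zs e = 1.
  have := zs_s e; have := zs_s (- e); rewrite (linear_formN _ lzs); lra.
have ys_dual : is_dual ys.
  apply: (linear_form_is_dual lys (C := CN)) => y; apply: le_trans (ggN _) _.
  apply: le_trans (NC _) _; rewrite ler_pM2l //.
  by apply: pairN; rewrite ?normr0.
(* Equal displacements in both copies of [W] make [N] vanish, so [a + b] is nonnegative in every
   direction. *)
have ab0 h : a h + b h = 0.
  have key k : 0 <= a k + b k.
    have := ggN ((k, 0), (k, 0)); rewrite /N /= subrr !normr0 (sublinear0 ss).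
    have -> : gg ((k, 0), (k, 0)) = a k + b k.
      rewrite /a /b -linear_formD //; congr gg.
      by apply: injective_projections; apply: injective_projections; rewrite /= ?addr0 ?add0r.
    lra.
  have := key h; have := key (- h).
  rewrite /a /b (linear_formN _ la) (linear_formN _ lb) => h1 h2.
  by apply/eqP; rewrite eq_le h2 andbT; lra.
exists zs; split; first by split=> // z Kz; have := zs_s (- z);
  have := sK _ Kz; rewrite (linear_formN _ lzs); lra.
split=> //; exists ys; split=> //; exists a, b; split; [|split=> //].
  apply: (scalarized_limiting_subdiff cW aW _ r_gt0 Lg0 glip gS
    (zn := fun n z => - xs (phi n) ((0, z), (0, 0)))
    (an := fun n h => xs (phi n) ((h, 0), (0, 0)))
    (w := fun n => (v (phi n)).1.1) (Cz := CN + 1) (Ca := CN + 1)) => //.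
  - by apply: sum_norm_ge.
  - by move=> n t u u'; have [-> _ _ _] := pairV _ (lx (phi n)); ring.
  - move=> n z; rewrite -(linear_formN _ (lx _)); apply: le_trans (xsC _ _) _.
    by rewrite ler_pM2l // normrN; apply: pairN; rewrite ?normr0.
  - move=> z; apply: le_trans (zs_s z) _; apply: le_trans (sC z) _.
    by rewrite ler_wpM2r // /CN; lra.
  - move=> z ep /(gg_cvg ((0, z), (0, 0)))[M hM]; exists M => n /hM.
    by rewrite /zs -opprD normrN.
  - by move=> n; have [_ ? _ _] := pairV _ (lx (phi n)).
  - move=> n h; apply: le_trans (xsC _ _) _.
    by rewrite ler_pM2l //; apply: pairN; rewrite ?normr0.
  - move=> h; apply: le_trans (ggC _) _.
    by rewrite ler_pM2l //; apply: pairN; rewrite ?normr0.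
  - by move=> h ep; exact: gg_cvg.
  - exact: conv_fst (conv_fst vphi_cvg).
  - move=> n; have [_ vd _ _] := hxs (phi n); apply: le_trans (mu_r (phi n)).
    apply: le_trans vd; apply: le_trans (prod_norm_fst _).
    exact: (prod_norm_fst ((v (phi n)).1 - vb.1)).
  (* On the graph of [g] the product norm is at most [1 + Lg] times the displacement in [W], which
     turns the normal to the graph into a subgradient inequality; hence the divisions by
     [1 + Lg]. *)
  - move=> n ep ep0; have [[[vr vg] _] _ nx _] := hxs (phi n).
    have K0 : 0 < 1 + Lg by rewrite addr_gt0.
    have [_ [_ /(_ _ (divr_gt0 ep0 K0))[d [d0 hd]]]] := frechet_normal_fst nx.
    exists (d / 2 / (1 + Lg)) => [|x xr]; first by rewrite !divr_gt0.
    rewrite ler_pdivlMr // => xd; pose u : W * Z := (x, g x - g wb).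
    have uE : u - (v (phi n)).1 = (x - (v (phi n)).1.1, g x - g (v (phi n)).1.1).
      by apply: injective_projections; rewrite //= vg opprB addrA subrK.
    have un : `|u - (v (phi n)).1| <= (1 + Lg) * `|x - (v (phi n)).1.1|.
      have := glip _ _ xr vr; have x0 := normr_ge0 (x - (v (phi n)).1.1).
      have := mulr_ge0 (ltW Lg0) x0.
      by rewrite uE prod_norm_le /= => h1 h2; apply/andP; split; lra.
    have ud : nrm (u - (v (phi n)).1) < d by apply: le_lt_trans un _; lra.
    have Gu : G u by [].
    have := hd _ Gu ud; rewrite uE /nrm -uE => hu.
    have -> : xs (phi n) ((x - (v (phi n)).1.1, 0), (0, 0)) -
              - xs (phi n) ((0, g x - g (v (phi n)).1.1), (0, 0)) =
              xs (phi n) (u - (v (phi n)).1, 0).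
      rewrite opprK -(linear_formD _ _ (lx _)) uE; congr (xs _ _).
      by apply: injective_projections; apply: injective_projections; rewrite /= ?addr0 ?add0r.
    apply: le_trans hu _; rewrite mulrAC ler_pdivrMr // -mulrA ler_pM2l //.
    by rewrite mulrC.
(* This half of [gg] is already a pointwise limit of Frechet normals to the fixed set [graph H], so
   no second use of the rule is made here. *)
have bE : (fun z : W * Y => b z.1 - ys z.2) = (fun z => gg (0, z)).
  apply/funext => z; rewrite /b /ys opprK -(linear_formD _ _ lgg); congr gg.
  by apply: injective_projections; apply: injective_projections; rewrite /= ?addr0 ?add0r.
rewrite /normal_coderiv bE; split; [exact: H0|split].
  apply: (linear_form_is_dual (C := CN + 1)) => [t u u'|u].
    by rewrite -lgg; congr gg; apply: injective_projections; rewrite /= ?scaler0 ?addr0.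
  apply: le_trans (ggC _) _; rewrite ler_pM2l // prod_norm_le /= lexx normr0.
  by rewrite normr_ge0.
exists (fun n => (v (phi n)).2), (fun n h => xs (phi n) (0, h)).
split; [|split; [|split]].
- by move=> n; have [[]] := hxs (phi n).
- by apply/convP; exact: conv_snd vphi_cvg.
- move=> n; apply: frechet_normal_norm; last first.
    by have [_ _ nx _] := hxs (phi n); exact: (frechet_normal_snd nx).
  by apply: sum_norm_ge => //; apply: sum_norm_ge.
- by move=> h; apply/(@convP R R^o) => ep; exact: gg_cvg.
Qed.
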